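(* Let $n\geq 2$, $\delta\in(0,1)$, $\tau\in(0,\infty)$, and let $\Omega\subset\mathbb{R}^n$ be a domain satisfying the $\beta$-quasihyperbolic boundary condition for some $\beta\in(0,1]$. If $p\geq 1$, $$p\in\Big(\frac{1}{\delta}\Big(n-n\frac{2\beta}{1+\beta}\Big),\,n\Big)\quad\text{and}\quad q\in\Big[p,\ \frac{2\beta}{1+\beta}\,\frac{np}{n-p\delta}\Big),$$ then $\Omega$ is a fractional $(q,p)$-Sobolev-Poincaré domain, i.e. there is a constant $C$ such that for every $u\in C(\Omega)$ $$\int_\Omega|u(x)-u_\Omega|^q\,dx\leq C\Big(\int_\Omega\int_{\Omega\cap B(x,\tau d(x,\partial\Omega))}\frac{|u(x)-u(y)|^p}{|x-y|^{n+p\delta}}\,dy\,dx\Big)^{q/p}.$$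
   Context: For a domain $\Omega\subsetneq\mathbb{R}^n$ the quasihyperbolic metric is $k_\Omega(x,y)=\inf_\gamma\int_\gamma\frac{ds}{d(z,\partial\Omega)}$, where the infimum is over all rectifiable curves $\gamma$ in $\Omega$ joining $x$ to $y$, $z$ is the point running along $\gamma$, $ds$ is arc length, and $d(\cdot,\partial\Omega)$ is the Euclidean distance to the boundary. $\Omega$ satisfies the $\beta$-quasihyperbolic boundary condition, $\beta\in(0,1]$, if there exist a point $x_0\in\Omega$ and a constant $C_0$ such that $$k_\Omega(x,x_0)\leq\frac{1}{\beta}\log\frac{d(x_0,\partial\Omega)}{d(x,\partial\Omega)}+C_0\quad\text{for all }x\in\Omega.$$ $C(\Omega)$ is the set of continuous real-valued functions on $\Omega$; $u_\Omega=\frac{1}{|\Omega|}\int_\Omega u(x)\,dx$; $B(x,r)$ is the Euclidean ball with centre $x$ and radius $r$. *)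

(* Defs.v *)
From HB Require Import structures.
From mathcomp Require Import all_boot all_order all_algebra.
From mathcomp Require Import all_classical all_reals all_analysis.

Set Implicit Arguments.
Unset Strict Implicit.
Unset Printing Implicit Defensive.

Import Order.TTheory GRing.Theory Num.Theory.
Import numFieldNormedType.Exports.

Local Open Scope classical_set_scope.
Local Open Scope ring_scope.

(* The library's topology on 'rV[R]_n is the usual one of R^n, but its norm is
   the max norm, hence the separate Euclidean norm. *)
Section euclidean.
Context {R : realType} {n : nat}.

Definition enorm (v : 'rV[R]_n) : R := Num.sqrt (\sum_(i < n) v 0 i ^+ 2).

Definition eball (x : 'rV[R]_n) (r : R) : set 'rV[R]_n :=
  [set y | enorm (y - x) < r].

Definition boundary (Omega : set 'rV[R]_n) : set 'rV[R]_n :=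
  closure Omega `\` Omega^°.

(* The Euclidean distance. It is the junk value [inf set0 = 0] when the boundary
   is empty, which cannot happen for a proper domain. *)
Definition dist_boundary (Omega : set 'rV[R]_n) (x : 'rV[R]_n) : R :=
  inf [set enorm (x - z) | z in boundary Omega].

Definition domain (Omega : set 'rV[R]_n) : Prop :=
  [/\ open Omega, connected Omega & Omega !=set0].

Definition proper_domain (Omega : set 'rV[R]_n) : Prop :=
  domain Omega /\ Omega != setT.

End euclidean.

(* 'rV[R]_n carries the sigma-algebra generated by the coordinates, that is,
   the Borel sigma-algebra. *)
Section measurable_rV.
Context {R : realType} {n : nat}.

Let coord : 'I_n -> 'rV[R]_n -> measurableTypeR R := fun i v => v 0 i.

Let rV_set0 : g_sigma_preimage coord set0.
Proof. exact: sigma_algebra0. Qed.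

Let rV_setC A : g_sigma_preimage coord A -> g_sigma_preimage coord (~` A).
Proof. exact: sigma_algebraC. Qed.

Let rV_bigcup (F : (set 'rV[R]_n)^nat) :
  (forall i, g_sigma_preimage coord (F i)) ->
  g_sigma_preimage coord (\bigcup_i F i).
Proof. exact: sigma_algebra_bigcup. Qed.

HB.instance Definition _ := @isMeasurable.Build default_measure_display
  'rV[R]_n (g_sigma_preimage coord) rV_set0 rV_setC rV_bigcup.

End measurable_rV.

Section measurable_rV_lemmas.
Context {R : realType}.

Lemma measurable_coord_rV n (i : 'I_n) :
  measurable_fun [set: 'rV[R]_n]
    (fun v : 'rV[R]_n => v 0 i : measurableTypeR R).
Proof.
move=> _ Y mY; rewrite setTI; apply: sub_sigma_algebra => /=.
rewrite -bigcup_seq/=; exists i => /=; first by rewrite mem_index_enum.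
by exists Y => //; rewrite setTI.
Qed.

Lemma measurable_fun_rV d (T : measurableType d) n (f : T -> 'rV[R]_n) :
  (forall i, measurable_fun [set: T] (fun t => f t 0 i : measurableTypeR R)) ->
  measurable_fun [set: T] f.
Proof.
move=> mf _ Y mY; rewrite setTI; move: Y mY.
pose M : set (set 'rV[R]_n) := [set Y | measurable (f @^-1` Y)].
suff : measurable `<=` M by apply.
apply: smallest_sub.
  split => [|A|F].
  - by rewrite /M/= preimage_set0.
  - by rewrite /M/= setTD preimage_setC => /measurableC.
  - by rewrite /M/= preimage_bigcup => mF; exact: bigcup_measurable.
move=> Y; rewrite -bigcup_seq/= => -[i _ [Z mZ <-]].
rewrite /M/= setTI -comp_preimage.
by have := mf i measurableT Z mZ; rewrite setTI.
Qed.

Definition rV_cons n (p : measurableTypeR R * 'rV[R]_n) : 'rV[R]_n.+1 :=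
  \row_i (if unlift ord0 i is Some j then p.2 0 j else p.1).

Definition rV_uncons n (v : 'rV[R]_n.+1) : measurableTypeR R * 'rV[R]_n :=
  (v 0 0, \row_i v 0 (lift ord0 i)).

Lemma rV_consK n : cancel (@rV_cons n) (@rV_uncons n).
Proof.
move=> [a v]; rewrite /rV_uncons /rV_cons/= mxE unlift_none; congr (_, _).
by apply/rowP => i; rewrite !mxE liftK.
Qed.

Lemma measurable_rV_cons n : measurable_fun setT (@rV_cons n).
Proof.
apply: measurable_fun_rV => i; case: (unliftP ord0 i) => [j ->|->].
  rewrite (_ : (fun _ => _) =
      (fun v : 'rV[R]_n => v 0 j : measurableTypeR R) \o snd).
    by apply: measurableT_comp => //; exact: measurable_coord_rV.
  by apply/funext => -[a v]/=; rewrite mxE liftK.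
rewrite (_ : (fun _ => _) = fst); first exact: measurable_fst.
by apply/funext => -[a v]/=; rewrite mxE unlift_none.
Qed.

Lemma measurable_rV_uncons n : measurable_fun setT (@rV_uncons n).
Proof.
apply/measurable_fun_pairP; split; first exact: measurable_coord_rV.
apply: measurable_fun_rV => i.
rewrite (_ : (fun _ => _) =
    fun v : 'rV[R]_n.+1 => v 0 (lift ord0 i) : measurableTypeR R).
  exact: measurable_coord_rV.
by apply/funext => v/=; rewrite mxE.
Qed.

End measurable_rV_lemmas.

Section lebesgue_step.
Context {R : realType} {n : nat}.
Variable m : {sigma_finite_measure set 'rV[R]_n -> \bar R}.

Definition lebesgue_step : set 'rV[R]_n.+1 -> \bar R :=
  pushforward (@lebesgue_measure R \x m)%E (@rV_cons R n).

Let mc := @measurable_rV_cons R n.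

Let lebesgue_step0 : lebesgue_step set0 = 0%E.
Proof. by rewrite /lebesgue_step /pushforward preimage_set0 measure0. Qed.

Let lebesgue_step_ge0 A : (0 <= lebesgue_step A)%E.
Proof. exact: measure_ge0. Qed.

Let lebesgue_step_sigma_additive : semi_sigma_additive lebesgue_step.
Proof. exact: (measure_semi_sigma_additive (s := pushforward _ _)). Qed.

HB.instance Definition _ := isMeasure.Build _ _ _ lebesgue_step
  lebesgue_step0 lebesgue_step_ge0 lebesgue_step_sigma_additive.

Let lebesgue_step_sigma_finite : sigma_finite setT lebesgue_step.
Proof.
have /sigma_finiteP[F [TF ndF Foo]] := sigma_finiteT (@lebesgue_measure R).
have /sigma_finiteP[G [TG ndG Goo]] := sigma_finiteT m.
exists (fun k => @rV_uncons R n @^-1` (F k `*` G k)).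
  apply/seteqP; split => // v _.
  have [i _ Fi] : (\bigcup_k F k) (rV_uncons v).1 by rewrite -TF.
  have [j _ Gj] : (\bigcup_k G k) (rV_uncons v).2 by rewrite -TG.
  exists (maxn i j) => //; split => /=.
  - by move: Fi; exact/subsetPset/ndF/leq_maxl.
  - by move: Gj; exact/subsetPset/ndG/leq_maxr.
move=> k; have [mFk Fkoo] := Foo k; have [mGk Gkoo] := Goo k; split.
  rewrite -[X in measurable X]setTI.
  by apply: measurable_rV_uncons => //; exact: measurableX.
rewrite /lebesgue_step /pushforward -comp_preimage.
rewrite (_ : _ \o _ = id); last by apply/funext => p; exact: rV_consK.
by rewrite preimage_id product_measure1E// lte_mul_pinfty// ge0_fin_numE.
Qed.

HB.instance Definition _ := Measure_isSigmaFinite.Build _ _ _ lebesgue_step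
  lebesgue_step_sigma_finite.

End lebesgue_step.

(* n-dimensional Lebesgue measure: n-fold product of [lebesgue_measure], carried
   over to row vectors; on 'rV_0 it is the unit mass. *)
Fixpoint lebesgue_rV {R : realType} (n : nat) :
    {sigma_finite_measure set 'rV[R]_n -> \bar R} :=
  match n with
  | 0 => \d_(0 : 'rV[R]_0)
  | n'.+1 => lebesgue_step (lebesgue_rV n')
  end.

Section quasihyperbolic.
Context {R : realType} {n : nat}.
Implicit Types (g : R -> 'rV[R]_n) (Omega : set 'rV[R]_n).

(* Same shape as the library's [variation] and [total_variation], which only
   concern real-valued functions. *)
Definition curve_variation a b g (s : seq R) : R :=
  let F := g \o nth b (a :: s) in \sum_(0 <= k < size s) enorm (F k.+1 - F k).

Definition curve_length a b g : \bar R :=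
  ereal_sup [set (curve_variation a b g s)%:E | s in itv_partition a b].

(* Curves are parametrized by [0, 1]. *)
Definition rectifiable_curve Omega (x y : 'rV[R]_n) g : Prop :=
  [/\ {within `[0, 1], continuous g}, g @` `[0, 1] `<=` Omega,
      g 0 = x, g 1 = y & (curve_length 0%R 1%R g < +oo)%E].

(* The arc-length parametrization of [g]: its value at [s] is [g t] for the
   first [t] such that the length of [g] on [0, t] reaches [s]. *)
Definition arc_param g (s : R) : 'rV[R]_n :=
  g (inf [set t | t \in `[0, 1] /\ (s%:E <= curve_length 0%R t g)%E]).

Definition arc_integral (f : 'rV[R]_n -> R) g : \bar R :=
  (\int[@lebesgue_measure R]_(s in `[0%R, fine (curve_length 0%R 1%R g)])
     (f (arc_param g s))%:E)%E.

Definition quasihyperbolic Omega (x y : 'rV[R]_n) : \bar R :=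
  ereal_inf [set arc_integral (fun z => (dist_boundary Omega z)^-1) g
            | g in rectifiable_curve Omega x y].

Definition qh_boundary_condition (beta : R) Omega : Prop :=
  exists2 x0, Omega x0 & exists C0 : R, forall x, Omega x ->
    (quasihyperbolic Omega x x0 <=
     (beta^-1 * ln (dist_boundary Omega x0 / dist_boundary Omega x)
      + C0)%:E)%E.

End quasihyperbolic.

Section sobolev_poincare.
Context {R : realType} {n : nat}.
Implicit Types (u : 'rV[R]_n -> R) (Omega : set 'rV[R]_n).

(* [\int] in [R] is [fine] of the integral, so a non-integrable [u] gets the
   average 0. When [Omega] has finite measure and [1 <= q], the left-hand side
   below is then infinite, so the inequality says that the right-hand side is
   infinite too. *)
Definition average Omega u : R :=
  (fine (lebesgue_rV n Omega))^-1 * \int[lebesgue_rV n]_(x in Omega) u x.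

Definition fractional_sobolev_poincare (delta tau q p : R) Omega : Prop :=
  exists C : R, forall u, {within Omega, continuous u} ->
    (\int[lebesgue_rV n]_(x in Omega) (`|u x - average Omega u| `^ q)%:E <=
     C%:E *
     (\int[lebesgue_rV n]_(x in Omega)
       \int[lebesgue_rV n]_(y in Omega `&`
                                 eball x (tau * dist_boundary Omega x))
         (`|u x - u y| `^ p / enorm (x - y) `^ (n%:R + p * delta))%:E)
     `^ (q / p))%E.

End sobolev_poincare.

(* Main.v *)
(* A path of almost minimal quasihyperbolic length from [x] to [x0] is cut into
   a chain of points [z_i] with steps comparable to [d(z_i)]; along a chain with
   the fewest steps the boundary condition applies to every initial part, so
   [d(z_i)] decays geometrically in [i].  Playing this decay against the trivial
   bound [d(z_j) <= (1 + c)^(j - i) d(z_i)] gives [|x - z_i| <= C d(z_i)^s] for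
   every [s < 2 beta / (1 + beta)].  Prolong the chain by cubes shrinking to [x].
   In each cube Chebyshev's inequality provides a point [y_i] where the density
   [G(y) = \int |u(y) - u(z)|^p / |y - z|^(n + p delta) dz] is at most three
   times its mean, and such that
   [|u(y_i) - u(y_(i+1))|^p <= C r_i^(p delta - n) \int_(Q_i) G].
   Since [|x - y| <= C r_i^s] on [Q_i], these increments are bounded by
   [r_i^eps] times a power of [\int |x - y|^(-b) G(y) dy] with [b < n]; they sum
   to a bound for [|u(x) - u(y_0)|^q] which is integrated in [x] by Tonelli. *)

(* The bound on q says exactly that t = q (n - p delta) / (n p) lies below 2 beta / (1 + beta),
   which leaves room for some s with t < s. The margin s - t pays for all that is not sharp: the
   potential has exponent b = n (s + t) / (2 s) < n, so Tonelli alone integrates it, and the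
   increments keep a factor r_i^eps that makes them summable. The value 2 beta / (1 + beta) is the
   limit of (b1 + b2) / (1 + b1) as b1 < b2 increase to beta. Chosen points replace averages of u
   over cubes: u is only continuous, and its values at points tending to x converge to u(x) without
   any differentiation theorem. The point y_0 is chosen before x, in the one cube where all chains
   begin; hence u(y_0) is a constant and can be exchanged for the average of u at the end. The power
   q / p of the mass I of a cube is reduced to the first power by I^(q/p) <= J^(q/p - 1) I, where J
   is the total energy; this produces the exponent q / p on the right-hand side. *)
Require Import Defs.
From mathcomp Require Import all_boot all_order all_algebra.
From mathcomp Require Import all_classical all_reals all_analysis.
From mathcomp Require Import measurable_realfun ring lra.

Set Implicit Arguments.
Unset Strict Implicit.
Unset Printing Implicit Defensive.

Import Order.TTheory GRing.Theory Num.Theory.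
Import numFieldNormedType.Exports.

Local Open Scope classical_set_scope.
Local Open Scope ring_scope.

(** * Euclidean norm and cubes *)

Section euclidean_norm.
Context {R : realType} {n : nat}.
Implicit Types (v w x y z : 'rV[R]_n).

Lemma enorm_ge0 v : 0 <= enorm v. Proof. exact: sqrtr_ge0. Qed.

Lemma sqr_enorm v : enorm v ^+ 2 = \sum_i v 0 i ^+ 2.
Proof. by rewrite sqr_sqrtr// sumr_ge0// => i _; exact: sqr_ge0. Qed.

Lemma enorm0 : enorm (0 : 'rV[R]_n) = 0.
Proof. by rewrite /enorm big1 ?sqrtr0// => i _; rewrite mxE expr0n. Qed.

Lemma enormZ (t : R) v : enorm (t *: v) = `|t| * enorm v.
Proof.
rewrite /enorm -sqrtr_sqr -sqrtrM ?sqr_ge0//; congr Num.sqrt.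
by rewrite mulr_sumr; apply: eq_bigr => i _; rewrite mxE exprMn.
Qed.

Lemma enormN v : enorm (- v) = enorm v.
Proof. by rewrite -scaleN1r enormZ normrN1 mul1r. Qed.

Lemma enormB v w : enorm (v - w) = enorm (w - v).
Proof. by rewrite -enormN opprB. Qed.

Lemma coord_le_enorm v i : `|v 0 i| <= enorm v.
Proof.
rewrite -sqrtr_sqr ler_wsqrtr// (bigD1 i)//= lerDl sumr_ge0// => j _.
exact: sqr_ge0.
Qed.

Lemma enorm_le v r : 0 <= r -> (forall i, `|v 0 i| <= r) -> enorm v <= n%:R * r.
Proof.
move=> r0 vr; rewrite -ler_sqr ?nnegrE ?mulr_ge0 ?enorm_ge0// sqr_enorm.
apply: (@le_trans _ _ (\sum_(i < n) r ^+ 2)).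
  by apply: ler_sum => i _; rewrite -(real_normK (num_real _)) ler_sqr ?nnegrE.
rewrite sumr_const card_ord -[leLHS]mulr_natl exprMn ler_wpM2r ?sqr_ge0//.
by rewrite -natrX ler_nat -mulnn; case: (n) => // k; rewrite leq_pmulr.
Qed.

(** Cauchy-Schwarz: the sum of the squares (v_i |w| - w_i |v|)^2 equals 2 |v| |w| (|v| |w| - v.w),
    which settles the case of two nonzero norms. *)
Lemma enorm_dot_le v w : \sum_i v 0 i * w 0 i <= enorm v * enorm w.
Proof.
have [v0|v0] := eqVneq (enorm v) 0.
  rewrite v0 mul0r big1// => i _; apply/eqP; rewrite mulf_eq0; apply/orP; left.
  by rewrite -normr_le0 -v0 coord_le_enorm.
have [w0|w0] := eqVneq (enorm w) 0.
  rewrite w0 mulr0 big1// => i _; apply/eqP; rewrite mulf_eq0; apply/orP; right.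
  by rewrite -normr_le0 -w0 coord_le_enorm.
have vp : 0 < enorm v by rewrite lt_def v0 enorm_ge0.
have wp : 0 < enorm w by rewrite lt_def w0 enorm_ge0.
have : 0 <= \sum_i (v 0 i * enorm w - w 0 i * enorm v) ^+ 2.
  by apply: sumr_ge0 => i _; exact: sqr_ge0.
rewrite (eq_bigr (fun i => enorm w ^+ 2 * v 0 i ^+ 2 + enorm v ^+ 2 * w 0 i ^+ 2
  - (enorm v * enorm w *+ 2) * (v 0 i * w 0 i))); last by move=> i _; ring.
rewrite big_split/= big_split/= sumrN -!mulr_sumr -!sqr_enorm.
rewrite (_ : _ - _ = (enorm v * enorm w *+ 2) *
  (enorm v * enorm w - \sum_i v 0 i * w 0 i)); last by ring.
by rewrite pmulr_rge0 ?subr_ge0// pmulrn_rgt0// mulr_gt0.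
Qed.

Lemma ler_enormD v w : enorm (v + w) <= enorm v + enorm w.
Proof.
rewrite -ler_sqr ?nnegrE ?addr_ge0 ?enorm_ge0// sqr_enorm sqrrD !sqr_enorm.
rewrite (eq_bigr (fun i => v 0 i ^+ 2 + w 0 i ^+ 2 + 2 * (v 0 i * w 0 i)));
  last first.
  by move=> i _; rewrite mxE; ring.
rewrite big_split/= big_split/= -mulr_sumr.
have := enorm_dot_le v w; lra.
Qed.

Lemma enorm_triangle y x z : enorm (x - z) <= enorm (x - y) + enorm (y - z).
Proof. by rewrite -(subrKA y x (-z)) ler_enormD. Qed.

Lemma mx_norm_le_enorm v : `|v| <= enorm v.
Proof.
rewrite [leLHS]mx_normrE; apply: bigmax_le; first exact: enorm_ge0.
by move=> [i j] _ /=; rewrite (ord1 i) coord_le_enorm.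
Qed.

End euclidean_norm.

Section cubes.
Context {R : realType} {n : nat}.
Implicit Types (x y z : 'rV[R]_n).

(** Cubes are preferred to Euclidean balls because they are products of intervals: their measure
    follows by induction on the dimension, and they are a neighbourhood basis for the max norm. *)
Definition cube z (r : R) : set 'rV[R]_n :=
  [set y | forall i, `|y 0 i - z 0 i| < r].

Lemma cubeC x y r : cube x r y -> cube y r x.
Proof. by move=> xy i; rewrite distrC. Qed.

Lemma enorm_lt_cube y z r : enorm (y - z) < r -> cube z r y.
Proof.
by move=> yz i; apply: le_lt_trans yz; have := coord_le_enorm (y - z) i;
  rewrite !mxE.
Qed.

Lemma cube_enorm_le y z r : 0 <= r -> cube z r y -> enorm (y - z) <= n%:R * r.
Proof. by move=> r0 yz; apply: enorm_le => // i; rewrite !mxE ltW. Qed.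

Lemma cube_nbhs z r : 0 < r -> nbhs z (cube z r).
Proof.
move=> r0; apply/nbhs_ballP; exists r => // y [_ zy] i.
by have := zy 0 i; rewrite -ball_normE /ball_/= distrC.
Qed.

Lemma nbhs_cube z (A : set 'rV[R]_n) : nbhs z A ->
  exists2 r, 0 < r & cube z r `<=` A.
Proof.
move=> /nbhs_ballP[r/= r0 rA]; exists r => // y zy; apply: rA; split => // i j.
by rewrite (ord1 i) -ball_normE /ball_/= distrC.
Qed.

Lemma lip_enorm_continuous (f : 'rV[R]_n -> R) :
  (forall x y, f x <= f y + enorm (x - y)) -> continuous f.
Proof.
move=> flip x; apply/(@cvgrPdist_lt _ _ _ _ (nbhs_filter x)) => e e0.
(* A cube of radius e / (n + 1) has Euclidean radius at most n e / (n + 1) < e; the successor also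
   covers dimension 0. *)
have r0 : 0 < e / n.+1%:R by rewrite divr_gt0.
apply: filterS (cube_nbhs x r0) => y /(cube_enorm_le (ltW r0)) yx.
have {}yx : enorm (y - x) < e.
  apply: le_lt_trans yx _; rewrite mulrCA gtr_pMr// ltr_pdivrMr// mul1r.
  by rewrite ltr_nat.
have := flip x y; have := flip y x.
rewrite (enormB x y) => h1 h2; rewrite ltr_distl; apply/andP; split; lra.
Qed.

Lemma enorm_continuous : continuous (@enorm R n).
Proof.
by apply: lip_enorm_continuous => x y; rewrite -{1}(subrK y x) addrC ler_enormD.
Qed.

Lemma measurable_cube z r : measurable (cube z r).
Proof.
rewrite (_ : cube z r = \big[setI/setT]_(i < n)
    ((fun y : 'rV[R]_n => y 0 i : measurableTypeR R) @^-1` ball (z 0 i) r)).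
  apply: bigsetI_measurable => i _; rewrite -[X in measurable X]setTI.
  by apply: measurable_coord_rV => //; exact: measurable_ball.
rewrite -bigcap_seq; apply/seteqP; split => y/=.
  by move=> yz i _; rewrite -ball_normE /ball_/= distrC.
by move=> yz i; have := yz i (mem_index_enum i);
  rewrite -ball_normE /ball_/= distrC.
Qed.

(** The sigma-algebra is generated by the coordinates, not by the open sets, so U is written as a
    countable union of cubes with rational centres and radii 1 / (k + 1). *)
Lemma open_measurable_rV (U : set 'rV[R]_n) : open U -> measurable U.
Proof.
move=> oU.
pose c (a : 'rV[rat]_n * nat) := cube (map_mx ratr a.1) (a.2.+1%:R^-1 : R).
rewrite (_ : U = \bigcup_(a in [set a | c a `<=` U]) c a).
  rewrite bigcup_mkcond; apply: countable_bigcupT_measurable => // a.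
  by case: ifP => // _; exact: measurable_cube.
apply/seteqP; split => [x Ux|x [a /= + ca]]; last exact.
have [r r0 rU] := nbhs_cube (open_nbhs_nbhs (conj oU Ux)).
have [k kr] : exists k, k.+1%:R^-1 < r / 2 :> R.
  exists (Num.truncn ((r / 2)^-1)); rewrite invf_plt ?posrE ?ltr0n ?divr_gt0//.
  exact: truncnS_gt.
move: kr; set e := (_^-1 : R) => kr.
have e0 : 0 < e by rewrite invr_gt0.
have ra i : exists a : rat, `|x 0 i - ratr a| < e.
  have /rat_in_itvoo[a] : x 0 i - e < x 0 i + e by lra.
  rewrite in_itv/= => /andP[a1 a2]; exists a.
  by rewrite ltr_distlC; apply/andP; split; lra.
have [a aE] := choice ra.
exists (\row_i a i, k) => /=.
  move=> y ay; apply: rU => i; have := aE i.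
  have : `|y 0 i - ratr (a i)| < e by have := ay i; rewrite !mxE.
  have := ler_distD (ratr (a i)) (y 0 i) (x 0 i);
    rewrite (distrC (ratr _) (x 0 i)).
  lra.
by move=> i; rewrite !mxE/=.
Qed.

Lemma continuous_measurable_rV (f : 'rV[R]_n -> R) : continuous f ->
  measurable_fun setT f.
Proof.
move=> /continuousP fo; apply: (measurability _ (RGenOpens.measurableE R)).
by move=> _ -[_ [a [b ->] <-]]; rewrite setTI; apply: open_measurable_rV;
  apply: fo; exact: interval_open.
Qed.

End cubes.

Lemma within_continuous_measurable_rV {R : realType} n (A : set 'rV[R]_n)
    (f : 'rV[R]_n -> R) : open A -> {within A, continuous f} ->
  measurable_fun A f.
Proof.
move=> oA; rewrite continuous_open_subspace// => fc.
apply: (measurability _ (RGenOpens.measurableE R)) => _ -[_ [a [b ->] <-]].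
apply: open_measurable_rV; rewrite openE => x [Ax fx].
apply: filterI; first by apply: open_nbhs_nbhs; split.
by apply: fc; rewrite ?inE//; apply: open_nbhs_nbhs; split => //;
  exact: interval_open.
Qed.

Lemma lebesgue_cube {R : realType} n (z : 'rV[R]_n) r : 0 <= r -> lebesgue_rV
  n (cube z r) = ((2 * r) ^+ n)%:E.
Proof.
move=> r0; elim: n z => [|m ih] z.
  by rewrite /= diracE expr0 mem_set// => -[].
rewrite /= /lebesgue_step /pushforward.
rewrite (_ : _ @^-1` _ = ball (z 0 0) r `*` cube (\row_i z 0 (lift ord0 i)) r).
  rewrite product_measure1E//; [|exact: measurable_ball|exact: measurable_cube].
  by rewrite ih /= (lebesgue_measure_ball (z 0 0) r0) -EFinM exprS mulr_natl.
apply/seteqP; split => [[a v]/= avz|[a v]/= [az vz] i].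
  split; first by have := avz 0; rewrite /rV_cons mxE unlift_none/=
    -ball_normE /ball_/= distrC.
  by move=> i; have := avz (lift ord0 i); rewrite !mxE liftK.
rewrite mxE; case: (unliftP ord0 i) => [j ->|->].
  by have := vz j; rewrite mxE.
by move: az; rewrite -ball_normE /ball_/= distrC.
Qed.

(** * Distance to the boundary *)

Section distance_to_boundary.
Context {R : realType} {n : nat}.
Variable Omega : set 'rV[R]_n.
Hypothesis Omega_domain : proper_domain Omega.
Implicit Types (x y z : 'rV[R]_n).

Local Notation d := (dist_boundary Omega).

Let Omega_open : open Omega.
Proof. by case: Omega_domain => -[]. Qed.

(* The boundary point is where the segment from [x] to [y] first leaves
   [Omega]. *)
Lemma exists_boundary x y : Omega x -> ~ Omega y ->
  exists2 z, boundary Omega z & enorm (x - z) <= enorm (x - y).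
Proof.
move=> Ox Oy.
pose f (t : R) := x + t *: (y - x).
have fc t : {for t, continuous f}.
  by apply: cvgD; [exact: cvg_cst|apply: cvgZr_tmp; exact: cvg_id].
pose S := [set t : R | 0 <= t /\ ~ Omega (f t)].
have S1 : S 1 by split => //; rewrite /f scale1r addrC subrK.
have lS : lbound S 0 by move=> t [].
have iS : has_inf S by split; [exists 1|exists 0].
pose t0 := inf S.
have t0_ge0 : 0 <= t0 by apply: lb_le_inf => //; exists 1.
have t0_le1 : t0 <= 1 by apply: ge_inf => //; exists 0.
have below t : 0 <= t -> t < t0 -> Omega (f t).
  move=> tge0 tt0; apply: contrapT => Oft.
  by move: tt0; apply/negP; rewrite -leNgt ge_inf//; exists 0.
have nOt0 : ~ Omega (f t0).
  move=> Ot0.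
  have /nbhs_ballP[e/= e0 eO] : nbhs t0 (f @^-1` Omega).
    by apply: fc; apply: open_nbhs_nbhs; split.
  have [t St tt0] := inf_adherent e0 iS.
  apply: (proj2 St); apply: eO; rewrite /ball/= ltr_distlC.
  have : t0 <= t by apply: ge_inf => //; exists 0.
  by rewrite -/t0 in tt0; move=> tt; apply/andP; split; lra.
have t0_gt0 : 0 < t0.
  rewrite lt_def t0_ge0 andbT; apply/eqP => t00; apply: nOt0.
  by rewrite t00 /f scale0r addr0.
exists (f t0).
  split; last by move=> /interior_subset.
  move=> B /fc /nbhs_ballP[e/= e0 eB].
  pose t := Num.max 0 (t0 - e / 2).
  have tt0 : t < t0 by rewrite gt_max t0_gt0/=; lra.
  exists (f t); split; first by apply: below => //; rewrite le_max lexx.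
  apply: eB; rewrite /ball/= ltr_distlC.
  have : t0 - e / 2 <= t by rewrite le_max lexx orbT.
  by move=> ?; apply/andP; split; lra.
rewrite /f opprD addrA subrr add0r enormN enormZ ger0_norm// enormB.
by rewrite ler_piMl ?enorm_ge0.
Qed.

(** Makes the infimum in [dist_boundary] a genuine one, so that lower bounds can be passed to it. *)
Lemma boundary_neq0 : boundary Omega !=set0.
Proof.
case: Omega_domain => -[_ _ [x Ox] OT].
have [y Oy] : exists y, ~ Omega y.
  by apply/existsNP => OO; move/eqP: OT; apply; apply/seteqP; split.
by have [z bz _] := exists_boundary Ox Oy; exists z.
Qed.

Let dist_set_lb x : lbound [set enorm (x - z) | z in boundary Omega] 0.
Proof. by move=> _ [z _ <-]; exact: enorm_ge0. Qed.

Lemma dist_boundary_le x z : boundary Omega z -> d x <= enorm (x - z).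
Proof. by move=> bz; apply: ge_inf; [exists 0;
  exact: dist_set_lb|exists z]. Qed.

Lemma dist_boundary_ge x r : (forall z,
  boundary Omega z -> r <= enorm (x - z)) ->
  r <= d x.
Proof.
move=> rb; apply: lb_le_inf => [|_ [z bz <-]]; last exact: rb.
by have [z bz] := boundary_neq0; exists (enorm (x - z)), z.
Qed.

Lemma dist_boundary_ge0 x : 0 <= d x.
Proof. by apply: dist_boundary_ge => z _; exact: enorm_ge0. Qed.

Lemma dist_boundary_lip x y : d x <= d y + enorm (x - y).
Proof.
rewrite -lerBlDr; apply: dist_boundary_ge => z bz; rewrite lerBlDr addrC.
exact: le_trans (dist_boundary_le _ bz) (enorm_triangle _ _ _).
Qed.

Lemma dist_boundary_gt0 x : Omega x -> 0 < d x.
Proof.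
move=> Ox; have [r r0 rO] := nbhs_cube (open_nbhs_nbhs (conj Omega_open Ox)).
apply: (lt_le_trans r0); apply: dist_boundary_ge => z [_ nOz]; rewrite leNgt.
apply/negP; rewrite enormB => /enorm_lt_cube /rO Oz; apply: nOz.
by apply: open_nbhs_nbhs; split.
Qed.

Lemma dist_boundary_in x y : Omega x -> enorm (y - x) < d x -> Omega y.
Proof.
move=> Ox yx; apply: contrapT => Oy.
have [z bz] := exists_boundary Ox Oy.
have := dist_boundary_le x bz; rewrite enormB in yx; lra.
Qed.

Lemma dist_boundary_continuous : continuous d.
Proof. by apply: lip_enorm_continuous => x y; exact: dist_boundary_lip. Qed.

Lemma measurable_dist_boundary : measurable_fun setT d.
Proof. by apply: continuous_measurable_rV; exact: dist_boundary_continuous. Qed.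

End distance_to_boundary.

(** * Arc-length parametrization *)

Section arc_length_parametrization.
Context {R : realType} {n : nat}.
Implicit Types (g : R -> 'rV[R]_n) (Omega : set 'rV[R]_n).

(** The two variations use different end points as defaults of [nth]; the indices that occur are in
    range, so the defaults are never reached. *)
Lemma curve_variation_rcons a t t' g s : last a s = t ->
  curve_variation a t' g (rcons s t') =
  curve_variation a t g s + enorm (g t' - g t).
Proof.
move=> st; rewrite /curve_variation size_rcons big_nat_recr//=; congr (_ + _).
  rewrite big_nat_cond [RHS]big_nat_cond; apply: eq_bigr => k.
  rewrite andbT => /andP[_ ks]; congr (enorm (g _ - g _)).
    by rewrite nth_rcons ks; exact: set_nth_default.
  rewrite -rcons_cons nth_rcons /= ltnS ltnW//.
  by apply: set_nth_default => /=; rewrite ltnS ltnW.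
congr (enorm (g _ - g _)); first by rewrite nth_rcons ltnn eqxx.
by rewrite -rcons_cons nth_rcons /= ltnSn nth_last.
Qed.

(** This part of the additivity of length is enough: it gives nonnegativity and monotonicity of the
    length function and bounds the increments of [g] by those of the length. *)
Lemma curve_length_extend a t t' g : a <= t -> t <= t' ->
  (curve_length a t g + (enorm (g t' - g t))%:E <= curve_length a t' g)%E.
Proof.
move=> at1; rewrite le_eqVlt => /predU1P[<-|tt'].
  by rewrite subrr enorm0 adde0.
rewrite -leeBrDr//; apply: ge_ereal_sup => _ [s [sp /eqP sl] <-].
rewrite leeBrDr// -EFinD -(curve_variation_rcons _ _ sl).
apply: ereal_sup_ubound; exists (rcons s t') => //; split.
  by rewrite rcons_path sp sl.
by rewrite last_rcons.
Qed.

Lemma curve_lengthxx a g : curve_length a a g = 0%E.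
Proof.
apply/eqP; rewrite eq_le; apply/andP; split.
  apply: ge_ereal_sup => _ [s /itv_partitionxx -> <-].
  by rewrite /curve_variation big_geq.
apply: ereal_sup_ubound; exists [::]; first by split => /=.
by rewrite /curve_variation big_geq.
Qed.

Lemma curve_length_ge0 a t g : a <= t -> (0 <= curve_length a t g)%E.
Proof.
move=> at1; apply: le_trans (curve_length_extend g (lexx a) at1).
by rewrite curve_lengthxx add0e lee_fin enorm_ge0.
Qed.

Lemma within_continuous_enorm a b g t (e : R) : {within `[a, b],
  continuous g} ->
  t \in `[a, b] -> 0 < e ->
  exists2 r, 0 < r &
    forall t', t' \in `[a, b] -> `|t' - t| < r -> enorm (g t' - g t) < e.
Proof.
move=> /subspace_continuousP gc tab e0.
have r0 : 0 < e / n.+1%:R by rewrite divr_gt0.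
have /nbhs_ballP[r/= rp rP] := gc t tab _ (cube_nbhs (g t) r0).
exists r => // t' t'ab t't.
have bt : ball t r t' by rewrite /ball/= distrC.
have h := cube_enorm_le (ltW r0) (rP t' bt t'ab); apply: le_lt_trans h _.
by rewrite mulrCA gtr_pMr// ltr_pdivrMr// mul1r ltr_nat.
Qed.

Section rectifiable.
Variables (Omega : set 'rV[R]_n) (x y : 'rV[R]_n) (g : R -> 'rV[R]_n).
Hypothesis rg : rectifiable_curve Omega x y g.

Local Notation V t := (curve_length (0 : R) t g).
Local Notation L := (fine (curve_length (0 : R) 1 g)).

Let first (s : R) := [set t : R | t \in `[0, 1] /\ (s%:E <= V t)%E].

Let V1E : V 1 = L%:E.
Proof.
by case: rg => _ _ _ _ V1; rewrite fineK// ge0_fin_numE// curve_length_ge0.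
Qed.

Lemma fine_curve_length_ge0 : 0 <= L.
Proof. by rewrite fine_ge0// curve_length_ge0. Qed.

Let first1 s : s <= L -> first s 1.
Proof. by move=> sL; split; rewrite ?in_itv/= ?ler01 ?lexx// V1E lee_fin. Qed.

Let first_lb s : lbound (first s) 0.
Proof. by move=> t [/[!in_itv]/= /andP[]]. Qed.

Let first_itv s : s <= L -> inf (first s) \in `[0, 1].
Proof.
move=> sL; rewrite in_itv/=; apply/andP; split.
  by apply: lb_le_inf; [exists 1; exact: first1|exact: first_lb].
by apply: ge_inf; [exists 0; exact: first_lb|exact: first1].
Qed.

Let V_homo t t' : 0 <= t -> t <= t' -> (V t <= V t')%E.
Proof.
move=> t0 tt'; apply: le_trans (curve_length_extend g t0 tt').
by rewrite leeDl// lee_fin enorm_ge0.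
Qed.

Let V_above s t : s <= L -> inf (first s) < t -> (s%:E <= V t)%E.
Proof.
move=> sL st; have [t1 [t1i t1V] t1t] := inf_lt (ex_intro _ 1 (first1 sL)) st.
apply: le_trans t1V _; apply: V_homo (ltW t1t).
by move: t1i; rewrite in_itv/= => /andP[].
Qed.

Let V_below s t : t \in `[0, 1] -> t < inf (first s) -> (V t < s%:E)%E.
Proof.
move=> ti ts; rewrite ltNge; apply/negP => sV.
by move: ts; apply/negP; rewrite -leNgt ge_inf//; exists 0; exact: first_lb.
Qed.

Let gc := let: And5 gc _ _ _ _ := rg in gc.

Let first_close s e : s <= L -> 0 < e ->
  exists2 r, 0 < r & forall t, t \in `[0, 1] -> `|t - inf (first s)| < r ->
    enorm (g t - arc_param g s) < e.
Proof. by move=> sL e0; exact: within_continuous_enorm (first_itv sL) e0. Qed.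

Lemma arc_param_in s : s <= L -> Omega (arc_param g s).
Proof.
by move=> sL; case: rg => _ gO _ _ _; apply: gO; exists (inf (first s)) => //;
  exact: first_itv.
Qed.

(* The length function [V] need not be shown continuous: strictly between the
   times of [s] and [s'] it takes its values in [`[s, s'[]. *)
Lemma arc_param_lip s s' : 0 <= s -> s <= s' -> s' <= L ->
  enorm (arc_param g s' - arc_param g s) <= s' - s.
Proof.
move=> s0 ss' s'L; have sL := le_trans ss' s'L.
have /[!in_itv]/= /andP[a0 a1] := first_itv sL.
have /[!in_itv]/= /andP[b0 b1] := first_itv s'L.
have : inf (first s) <= inf (first s').
  apply: lb_le_inf; first by exists 1; exact: first1.
  move=> t [ti tV]; apply: ge_inf; first by exists 0; exact: first_lb.
  by split => //; apply: le_trans tV; rewrite lee_fin.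
rewrite le_eqVlt => /predU1P[ab|ab].
  by rewrite /arc_param -/(first s) -/(first s') ab subrr enorm0 subr_ge0.
apply/ler_addgt0Pr => e e0.
have e2 : 0 < e / 2 by rewrite divr_gt0.
have [r r0 rP] := first_close sL e2.
have [r' r'0 r'P] := first_close s'L e2.
set a := inf (first s) in a0 a1 ab rP *;
  set b := inf (first s') in b0 b1 ab r'P *.
(* [t] is just after [a] and [t'] just before [b]; the midpoint keeps t <= t'. Then the length is at
   least [s] at [t] and below [s'] at [t']. *)
pose m := (a + b) / 2.
pose t := Num.min m (a + r / 2); pose t' := Num.max m (b - r' / 2).
have tm : t <= m by rewrite ge_min lexx.
have mt' : m <= t' by rewrite le_max lexx.
have at1 : a < t by rewrite lt_min; apply/andP; split; rewrite /m; lra.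
have tr : t <= a + r / 2 by rewrite ge_min lexx orbT.
have t'b : t' < b by rewrite gt_max; apply/andP; split; rewrite /m; lra.
have t'r : b - r' / 2 <= t' by rewrite le_max lexx orbT.
have ti : t \in `[0, 1] by rewrite in_itv/=; apply/andP; split; lra.
have t'i : t' \in `[0, 1] by rewrite in_itv/=; apply/andP; split; lra.
have h1 : enorm (g t - arc_param g s) < e / 2.
  by apply: rP => //; rewrite ger0_norm -/a; lra.
have h2 : enorm (g t' - arc_param g s') < e / 2.
  by apply: r'P => //; rewrite ler0_norm -/b; lra.
have h3 : enorm (g t' - g t) <= s' - s.
  have t0 : 0 <= t by lra.
  have tt' : t <= t' by lra.
  have := curve_length_extend g t0 tt'.
  have := V_below t'i t'b; have := V_above sL at1.
  case: (V t) => [v| |]//; case: (V t') => [v'| |]//.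
  by rewrite -EFinD !lee_fin lte_fin; lra.
have := enorm_triangle (g t') (arc_param g s') (arc_param g s).
have := enorm_triangle (g t) (g t') (arc_param g s).
rewrite (enormB (arc_param g s') (g t')); lra.
Qed.

Lemma arc_param0 : arc_param g 0 = x.
Proof.
case: (rg) => _ _ <- _ _; rewrite /arc_param; congr g; apply/eqP.
rewrite eq_le; apply/andP; split; last first.
  by have /[!in_itv]/= /andP[] := first_itv fine_curve_length_ge0.
apply: ge_inf; first by exists 0; exact: first_lb.
by split; rewrite ?in_itv/= ?lexx ?ler01// curve_lengthxx.
Qed.

(** The full length may be attained before time 1; after that no length is left, so [g] cannot move
    and already sits at its end point. *)
Lemma arc_param_length : arc_param g L = y.
Proof.
case: (rg) => _ _ _ gy _; rewrite -gy.
have /[!in_itv]/= /andP[a0 a1] := first_itv (lexx L).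
move: a1; rewrite le_eqVlt => /predU1P[a1|a1]; first by rewrite /arc_param a1.
suff : enorm (arc_param g L - g 1) <= 0.
  move=> h; apply/eqP; rewrite -subr_eq0 -normr_le0.
  exact: le_trans (mx_norm_le_enorm _) h.
apply/ler_addgt0Pr => e e0; rewrite add0r.
have [r r0 rP] := first_close (lexx L) e0.
set a := inf (first L) in a0 a1 rP.
pose t := Num.min 1 (a + r / 2).
have t1 : t <= 1 by rewrite ge_min lexx.
have at1 : a < t by rewrite lt_min a1/=; lra.
have tr : t <= a + r / 2 by rewrite ge_min lexx orbT.
have ti : t \in `[0, 1] by rewrite in_itv/=; apply/andP; split; lra.
have h1 : enorm (g t - arc_param g L) < e.
  by apply: rP => //; rewrite ger0_norm -/a; lra.
have h2 : enorm (g 1 - g t) <= 0.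
  have t0 : 0 <= t by lra.
  have := curve_length_extend g t0 t1; have := V_above (lexx L) at1.
  rewrite V1E; case: (V t) => [v| |]//; rewrite -EFinD !lee_fin; lra.
have := enorm_triangle (g t) (arc_param g L) (g 1).
rewrite (enormB (arc_param g L) (g t)) (enormB (g t) (g 1)); lra.
Qed.

End rectifiable.
End arc_length_parametrization.

(** * Quasihyperbolic chains *)

Lemma integral_ge_cst d (T : measurableType d) (R : realType)
    (mu : {measure set T -> \bar R}) (A : set T) (f : T -> \bar R) (k : R) :
  measurable A -> measurable_fun A f -> 0 <= k ->
  (forall x, A x -> (k%:E <= f x)%E) -> (k%:E * mu A <= \int[mu]_(x in A) f
    x)%E.
Proof.
move=> mA mf k0 kf; rewrite -integral_cst//.
by apply: ge0_le_integral => // x Ax; rewrite lee_fin.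
Qed.

Section chains.
Context {R : realType} {n : nat}.
Variable Omega : set 'rV[R]_n.
Implicit Types (x y z : 'rV[R]_n) (c : R).

Local Notation d := (dist_boundary Omega).

(** Smallness relative to the distance at both ends makes the relation symmetric, so chains can be
    reversed. *)
Definition chain_step c x y : Prop :=
  [/\ Omega x, Omega y, enorm (x - y) <= c * d x & enorm (x - y) <= c * d y].

Definition chain c N x y : Prop := exists z : nat -> 'rV[R]_n,
  [/\ z 0%N = x, z N = y & forall i, (i < N)%N -> chain_step c (z i) (z i.+1)].

Lemma chain_stepC c x y : chain_step c x y -> chain_step c y x.
Proof. by case=> Ox Oy dx dy; split=> //; rewrite enormB. Qed.

Lemma chain0 c x : chain c 0 x x.
Proof. by exists (fun=> x). Qed.

Lemma chain1 c x y : chain_step c x y -> chain c 1 x y.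
Proof. by move=> xy; exists (fun i => if i is 0%N then x else y);
  split=> // -[]. Qed.

Lemma chain_cat c N M x y z : chain c N x y -> chain c M y z ->
  chain c (N + M) x z.
Proof.
move=> [a [a0 aN aS]] [b [b0 bM bS]].
exists (fun i => if (i <= N)%N then a i else b (i - N)%N); split.
- by rewrite leq0n.
- case: M bM {bS} => [|M] bM; first by rewrite addn0 leqnn aN -bM b0.
  by rewrite addnS ltnNge leq_addr/= subSn ?leq_addr// addKn.
- move=> i iNM; case: (ltngtP i N) => [iN|iN|iN].
  + exact: aS.
  + by rewrite subSn ?(ltnW iN)//; apply: bS; rewrite ltn_subLR// ltnW.
  + rewrite iN aN -b0 subSnn; apply: bS.
    by move: iNM; rewrite iN -[X in (X < _)%N]addn0 ltn_add2l.
Qed.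

Lemma chain_sym c N x y : chain c N x y -> chain c N y x.
Proof.
move=> [a [a0 aN aS]]; exists (fun i => a (N - i)%N); split.
- by rewrite subn0.
- by rewrite subnn.
- move=> i iN; apply: chain_stepC.
  have := aS (N - i.+1)%N; rewrite -subSn// subSS; apply.
  by rewrite leq_subr.
Qed.

Hypothesis Omega_domain : proper_domain Omega.

(* Greedy subdivision of the path: each point is followed by the one at
   arc length [c / (1 + c)] times the distance to the boundary. *)
Lemma path_chain c (l M : R) (sg : R -> 'rV[R]_n) : 0 < c -> 0 <= l ->
  (forall s, 0 <= s -> s <= l -> Omega (sg s)) ->
  (forall s s', 0 <= s -> s <= s' -> s' <= l -> enorm (sg s' - sg s) <= s' -
    s) ->
  (\int[@lebesgue_measure R]_(s in `[0%R, l]) ((d (sg s))^-1)%:E <= M%:E)%E ->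
  exists2 N, chain c N (sg 0) (sg l) &
    N%:R * (c / (1 + 2 * c)) <= M + c / (1 + 2 * c).
Proof.
move=> c0 l0 Osg lip iM.
pose D s := d (sg s).
have D0 s : 0 <= s -> s <= l -> 0 < D s.
  by move=> s0 sl; apply: dist_boundary_gt0 => //; exact: Osg.
have Dlip s s' : 0 <= s -> s <= s' -> s' <= l ->
    D s' <= D s + (s' - s) /\ D s <= D s' + (s' - s).
  move=> s0 ss' s'l; have sl := lip _ _ s0 ss' s'l.
  have := dist_boundary_lip Omega_domain (sg s) (sg s').
  have := dist_boundary_lip Omega_domain (sg s') (sg s).
  rewrite (enormB (sg s)) -/(D s) -/(D s'); split; lra.
have Dc : {within `[0, l], continuous D}.
  apply/subspace_continuousP => s; rewrite /= in_itv/= => /andP[s0 sl].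
  apply/cvgrPdist_lt => e e0; apply/nbhs_ballP; exists e => //= s' ss'.
  rewrite /= in_itv/= => /andP[s'0 s'l]; move: ss'; rewrite /ball/= => ss'.
  have [ss|ss] := leP s s'.
    have [] := Dlip _ _ s0 ss s'l; move: ss'; rewrite ler0_norm ?subr_le0//.
    by move=> *; rewrite ltr_norml; apply/andP; split; lra.
  have [] := Dlip _ _ s'0 (ltW ss) sl; move: ss'; rewrite gtr0_norm ?subr_gt0//.
  by move=> *; rewrite ltr_norml; apply/andP; split; lra.
have mf : measurable_fun `[0, l] (fun s => ((D s)^-1)%:E).
  apply/measurable_EFinP; apply: subspace_continuous_measurable_fun => //.
  apply/subspace_continuousP => s s0l; apply: cvgV.
    by move: s0l; rewrite /= in_itv/= => /andP[s0 sl]; rewrite gt_eqF// D0.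
  by move/subspace_continuousP : Dc => Dc; exact: Dc.
(* Over an arc of length c' D(s) the distance drops at most to (1 - c') D(s), and c (1 - c') = c':
   the step is admissible from both ends. It rises at most to (1 + c') D(s), so a full step
   contributes at least c' / (1 + c') = [kap] to the quasihyperbolic integral. *)
pose c' := c / (1 + c).
pose kap := c / (1 + 2 * c).
have c'0 : 0 < c' by rewrite divr_gt0// addr_gt0.
have c'c : c' * (1 + c) = c by rewrite /c' divfK// gt_eqF// addr_gt0.
have kap0 : 0 < kap by rewrite divr_gt0// addr_gt0// mulr_gt0.
have kapc : kap = c' / (1 + c').
  by rewrite /kap /c'; field; rewrite !gt_eqF//; lra.
have step s s' : 0 <= s -> s <= s' -> s' <= l -> s' - s <= c' * D s ->
    chain_step c (sg s) (sg s').
  move=> s0 ss' s'l h; have sl := le_trans ss' s'l.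
  have Ds0 := D0 _ s0 sl; have [_ h1] := Dlip _ _ s0 ss' s'l.
  have h2 := lip _ _ s0 ss' s'l.
  split; [by apply: Osg|by apply: Osg => //; exact: le_trans ss'| |];
    rewrite enormB (le_trans h2)// (le_trans h)//.
    by rewrite ler_pM2r//; nra.
  by rewrite -/(D s'); nra.
pose t := fix t j := if j is j'.+1 then t j' + c' * D (t j') else 0.
have tP j : t j <= l -> [/\ 0 <= t j, chain c j (sg 0) (sg (t j)) &
    ((j%:R * kap)%:E <= \int[@lebesgue_measure R]_(s in `[0%R, t j])
      ((D s)^-1)%:E)%E].
  have D_ge0 s : 0 <= D s by exact: dist_boundary_ge0.
  elim: j => [|j ih] tl.
    split => //; first exact: chain0.
    by rewrite mul0r; apply: integral_ge0 => s;
      rewrite /= in_itv/= => /andP[s0 sl];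
      rewrite lee_fin invr_ge0 ltW// D0// (le_trans sl).
  have tt : t j <= t j.+1 by rewrite /= lerDl mulr_ge0// ltW.
  have tjl := le_trans tt tl.
  have [tj0 tjc tji] := ih tjl; have Dtj := D0 _ tj0 tjl.
  split; first exact: le_trans tt.
    rewrite -[X in chain c X]addn1; apply: chain_cat tjc _; apply: chain1.
    by apply: step => //; rewrite /= addrAC subrr add0r.
  have sub : (`[0%R, t j.+1] : set R) `<=` `[0%R, l].
    by move=> s; rewrite /= !in_itv/= => /andP[-> /le_trans]; apply.
  have pos s : [set` `[0%R, t j.+1]] s -> (0 <= ((D s)^-1)%:E)%E.
    move=> /sub; rewrite /= in_itv/= => /andP[s0 sl].
    by rewrite lee_fin invr_ge0 ltW// D0.
  have E : (`[0%R, t j.+1] = `[0%R, t j] `|` `]t j, t j.+1])%classic.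
    by apply: itv_bndbnd_setU; rewrite bnd_simp.
  rewrite E ge0_integral_setU//; last 3 first.
  - by rewrite -E; exact: measurable_funS mf.
  - by rewrite -E; exact: pos.
  - rewrite disj_set2E; apply/eqP/seteqP; split => // s [] /=;
    rewrite !in_itv/=.
    by move=> /andP[_ s1] /andP[s2 _]; have := lt_le_trans s2 s1; rewrite ltxx.
  rewrite mulrS mulrDl mul1r EFinD addeC; apply: leeD => //.
  pose k := ((1 + c') * D (t j))^-1.
  have -> : kap = k * (t j.+1 - t j).
    by rewrite /= addrAC subrr add0r kapc /k; field; rewrite !gt_eqF//; lra.
  have mt : lebesgue_measure (`]t j, t j.+1] : set R) = (t j.+1 - t j)%:E.
    move: (t j.+1) tt => t' tt; rewrite lebesgue_measure_itv/= lte_fin.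
    by move: tt; rewrite le_eqVlt => /predU1P[->|->]; rewrite ?ltxx ?subrr.
  rewrite EFinM -mt; apply: integral_ge_cst => //.
  - by apply: measurable_funS mf => //; apply: subset_trans sub; rewrite E;
    exact: subsetUr.
  - by rewrite invr_ge0 mulr_ge0 ?ltW// addr_gt0.
  move=> s; rewrite /= in_itv/= => /andP[ts st].
  have sl : s <= l by exact: le_trans tl.
  have s0 : 0 <= s by apply: le_trans (ltW ts).
  rewrite lee_fin lef_pV2 ?posrE ?D0 ?mulr_gt0 ?addr_gt0//.
  have [h _] := Dlip _ _ tj0 (ltW ts) sl; apply: le_trans h _.
  by move: st => /=; lra.
have tM j : t j <= l -> j%:R * kap <= M.
  move=> tl; have [tj0 _ h] := tP _ tl; rewrite -lee_fin.
  apply: le_trans h _; apply: le_trans iM; apply: ge0_subset_integral => //.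
    by move=> s; rewrite /= in_itv/= => /andP[s0 sl];
      rewrite lee_fin invr_ge0 ltW// D0.
  by move=> s; rewrite /= !in_itv/= => /andP[-> /le_trans]; apply.
(* Every full step inside [0, l] uses up [kap] of the integral, which is at most [M]; so the greedy
   sequence leaves [0, l]. *)
have exj : exists j, l < t j.
  apply/not_existsP => tl.
  have := tM (Num.truncn (M / kap)).+1.
  have -> : t (Num.truncn (M / kap)).+1 <= l by rewrite leNgt; apply/negP/tl.
  by move=> /(_ isT); rewrite -ler_pdivlMr// leNgt truncnS_gt.
case: (ex_minnP exj) => -[|j]; first by rewrite /= ltNge l0.
move=> ltj minj; have tjl : t j <= l.
  by rewrite leNgt; apply/negP => /minj; rewrite ltnn.
(* The last step is cut short to end at [l]; it accounts for the extra [kap] in the bound. *)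
have [tj0 tjc _] := tP _ tjl; exists j.+1.
  rewrite -[X in chain c X]addn1; apply: chain_cat tjc _; apply: chain1.
  apply: step => //; move: ltj => /=; lra.
by rewrite mulrS mulrDl mul1r addrC lerD2r; exact: tM.
Qed.

Lemma qh_chain beta c : qh_boundary_condition beta Omega -> 0 < c ->
  exists2 x0, Omega x0 & exists C : R, forall x, Omega x ->
    exists N (z : nat -> 'rV[R]_n), [/\ z 0%N = x0, z N = x,
      forall i, (i < N)%N -> chain_step c (z i) (z i.+1) &
      forall i, (i <= N)%N -> i%:R * (c / (1 + 2 * c)) <=
        beta^-1 * ln (d x0 / d (z i)) + C].
Proof.
move=> [x0 Ox0 [C0 qh]] c0; exists x0 => //.
pose kap := c / (1 + 2 * c).
have kap0 : 0 < kap by rewrite divr_gt0// addr_gt0// mulr_gt0.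
have reach x : Omega x -> exists2 N, chain c N x0 x &
    N%:R * kap <= beta^-1 * ln (d x0 / d x) + (C0 + 1 + kap).
  move=> Ox; have := qh x Ox; set K := (_ + C0) => KE.
  (* The infimum need not be attained; a slack of 1 is absorbed into the additive constant. *)
  have /ereal_inf_lt[_ [g rg <-]] : (quasihyperbolic Omega x x0 < (K + 1)%:E)%E.
    by apply: le_lt_trans KE _; rewrite lte_fin ltrDl.
  move=> /ltW; rewrite /arc_integral => gK.
  have Og s : 0 <= s -> s <= fine (curve_length 0 1 g) -> Omega (arc_param g s).
    by move=> _; exact: (arc_param_in rg).
  have [N ch NK] := path_chain c0 (fine_curve_length_ge0 g) Og (arc_param_lip
    rg) gK.
  exists N; last by rewrite (le_trans NK)// /K -/kap; lra.
  by apply: chain_sym; rewrite (arc_param0 rg) (arc_param_length rg) in ch.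
exists (C0 + 1 + kap) => x Ox.
have exN : exists N, `[< chain c N x0 x >].
  by have [N ch _] := reach x Ox; exists N; exact/asboolP.
case: (ex_minnP exN) => N /asboolP[z [z0 zN zS]] minN.
exists N, z; split=> // i iN.
have Ozi : Omega (z i).
  case: (ltngtP i N) iN => // [iN _|-> _]; first by have [] := zS _ iN.
  by rewrite zN.
(* The boundary condition at [z i] yields some chain of [M] steps from [x0] to [z i]. Followed by
   the rest of the minimal chain it cannot have fewer than [N] steps, hence i <= M. *)
have [M ch MK] := reach _ Ozi.
apply: le_trans MK; rewrite ler_pM2r// ler_nat.
have zix : chain c (N - i) (z i) x.
  exists (fun j => z (i + j)%N); split; rewrite ?addn0 ?subnKC//.
  by move=> j jN; rewrite addnS; apply: zS; rewrite -ltn_subRL.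
have := minN _ (asboolT (chain_cat ch zix)).
by rewrite addnC -leq_subLR subKn.
Qed.

End chains.

(** The induction carries the exact partial sums of the geometric series. It serves twice: for the
    displacement along a chain and for the increments of u. *)
Lemma geometric_step_le {R : realType} (D : nat -> R) (a q : R) m :
  0 <= a -> 0 <= q -> q < 1 -> D 0%N <= 0 ->
  (forall k, (k < m)%N -> D k.+1 <= D k + a * q ^+ k) -> D m <= a / (1 - q).
Proof.
move=> a0 q0 q1 D0 DS.
have h k : (k <= m)%N -> D k <= a / (1 - q) * (1 - q ^+ k).
  elim: k => [_|k ih km]; first by rewrite expr0 subrr mulr0.
  apply: (le_trans (DS _ km)); apply: (le_trans (lerD (ih (ltnW km)) (lexx _))).
  rewrite le_eqVlt; apply/orP; left; apply/eqP; rewrite exprS; field.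
  by rewrite subr_eq0 gt_eqF.
apply: le_trans (h _ (leqnn m)) _;
  rewrite ler_piMr ?divr_ge0 ?subr_ge0 ?(ltW q1)//.
by rewrite gerBl exprn_ge0.
Qed.

(** * Decay of the boundary distance along a chain *)

Section chain_geometry.
Context {R : realType} {n : nat}.
Variable Omega : set 'rV[R]_n.
Hypothesis Omega_domain : proper_domain Omega.
Implicit Types (x y z : 'rV[R]_n).

Local Notation d := (dist_boundary Omega).

Lemma chain_step_dist c x y : chain_step Omega c x y -> d y <= (1 + c) * d x.
Proof.
move=> [_ _ h _]; have := dist_boundary_lip Omega_domain y x.
rewrite (enormB y); lra.
Qed.

(* With [l i = ln (d (z i))] and [lam = ln (1 + c)], the three bounds
   [l j <= l i + lam * (j - i)], [l j <= A - b2 * lam * j] and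
   [l 0 - lam * i <= l i] are combined with weights [b1 / (1 + b1)] and
   [1 / (1 + b1)]; as [b1 < b2], what remains decays geometrically in [j - i].
     *)
Lemma chain_dist_decay b1 b2 c A N (z : nat -> 'rV[R]_n) :
  0 < b1 -> b1 < b2 -> 0 < c ->
  (forall i, (i < N)%N -> chain_step Omega c (z i) (z i.+1)) ->
  Omega (z 0%N) ->
  (forall i, (i <= N)%N -> ln (d (z i)) <= A - b2 * ln (1 + c) * i%:R) ->
  forall i j, (i <= j <= N)%N ->
    d (z j) <= expR ((A - b2 * ln (d (z 0%N))) / (1 + b1)) *
      d (z i) `^ ((b1 + b2) / (1 + b1)) *
      expR (- (ln (1 + c) * (b2 - b1) / (1 + b1))) ^+ (j - i).
Proof.
move=> b10 b12 c0 zS z0 zA i j /andP[ij jN].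
have Oz k : (k <= N)%N -> Omega (z k).
  by case: k => // k kN; have [] := zS _ kN.
have dz k : (k <= N)%N -> 0 < d (z k) by move=> kN;
  exact: dist_boundary_gt0 (Oz _ kN).
set lam := ln (1 + c).
have lS k : (k < N)%N -> ln (d (z k.+1)) <= ln (d (z k)) + lam.
  move=> kN; rewrite addrC -lnM ?posrE ?addr_gt0 ?dz// ?(ltnW kN)//.
  rewrite ler_ln ?posrE ?mulr_gt0 ?addr_gt0 ?dz// ?(ltnW kN)//.
  by apply: chain_step_dist; exact: zS.
have lS' k : (k < N)%N -> ln (d (z k)) <= ln (d (z k.+1)) + lam.
  move=> kN; rewrite addrC -lnM ?posrE ?addr_gt0 ?dz// ?(ltnW kN)//.
  rewrite ler_ln ?posrE ?mulr_gt0 ?addr_gt0 ?dz// ?(ltnW kN)//.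
  by apply: chain_step_dist; apply: chain_stepC; exact: zS.
have h1 k : (i + k <= N)%N -> ln (d (z (i + k)%N)) <= ln (d (z i)) + lam * k%:R.
  elim: k => [|k ih] ikN; first by rewrite addn0 mulr0 addr0.
  rewrite addnS in ikN *; have := ih (ltnW ikN); have := lS _ ikN.
  by rewrite mulrS; lra.
have h2 k : (k <= N)%N -> ln (d (z 0%N)) - lam * k%:R <= ln (d (z k)).
  elim: k => [|k ih] kN; first by rewrite mulr0 subr0.
  by have := ih (ltnW kN); have := lS' _ kN; rewrite mulrS; lra.
have iN := leq_trans ij jN.
rewrite -[leLHS]lnK ?posrE ?dz// /powR gt_eqF ?dz// -expRM_natr -!expRD
  ler_expR.
have := h1 (j - i)%N; rewrite subnKC// => /(_ jN).
have := h2 _ iN; have := zA _ jN; rewrite -/lam natrB//.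
set li := ln (d (z i)); set lj := ln (d (z j)); set l0 := ln (d (z 0%N)).
set I := i%:R; set J := j%:R => e1 e2 e3.
have b1p : 0 < 1 + b1 by lra.
rewrite -(ler_pM2l b1p) [leRHS](_ : _ = A - b2 * l0 + (b1 + b2) * li -
  lam * (b2 - b1) * (J - I)); last by field; lra.
have : b1 * lj <= b1 * (li + lam * (J - I)) by rewrite ler_pM2l.
have : b2 * (l0 - lam * I) <= b2 * li by rewrite ler_pM2l//; lra.
nra.
Qed.

(** The step from z_j has length at most c d(z_j), so the displacement after z_i is dominated by the
    geometric series that [chain_dist_decay] provides. *)
Lemma chain_enorm_le b1 b2 c A N (z : nat -> 'rV[R]_n) :
  0 < b1 -> b1 < b2 -> 0 < c ->
  (forall i, (i < N)%N -> chain_step Omega c (z i) (z i.+1)) ->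
  Omega (z 0%N) ->
  (forall i, (i <= N)%N -> ln (d (z i)) <= A - b2 * ln (1 + c) * i%:R) ->
  forall i, (i <= N)%N ->
    enorm (z N - z i) <= c * expR ((A - b2 * ln (d (z 0%N))) / (1 + b1)) *
       d (z i) `^ ((b1 + b2) / (1 + b1)) /
       (1 - expR (- (ln (1 + c) * (b2 - b1) / (1 + b1)))).
Proof.
move=> b10 b12 c0 zS z0 zA i iN.
have decay := chain_dist_decay b10 b12 c0 zS z0 zA.
have om0 : 0 < ln (1 + c) * (b2 - b1) / (1 + b1).
  by rewrite divr_gt0 ?mulr_gt0 ?ln_gt0 ?subr_gt0// ?addr_gt0// ltrDl.
rewrite -{1}(subnKC iN).
apply: (@geometric_step_le _ (fun k => enorm (z (i + k)%N - z i))).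
- by rewrite !mulr_ge0 ?expR_ge0 ?powR_ge0// ltW.
- exact: expR_ge0.
- by rewrite expR_lt1 oppr_lt0.
- by rewrite addn0 subrr enorm0.
move=> k kN; have ikN : (i + k < N)%N by rewrite -ltn_subRL.
apply: le_trans (enorm_triangle (z (i + k)%N) _ _) _;
  rewrite addrC addnS lerD2l.
have [_ _ h _] := zS _ ikN; rewrite enormB (le_trans h)//.
rewrite -!mulrA ler_pM2l// !mulrA -[X in _ ^+ X](addKn i k) decay//.
by rewrite leq_addr ltnW.
Qed.

End chain_geometry.

(** * Sequences of cubes shrinking to a given point *)

Section approach.
Context {R : realType} {n : nat}.
Variable Omega : set 'rV[R]_n.
Hypothesis Omega_domain : proper_domain Omega.
Implicit Types x y : 'rV[R]_n.

Local Notation d := (dist_boundary Omega).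

(* A chain of cubes with centres [z i] and radii [r i] from a fixed cube around
   [x0] which first follows a shortest chain to [x] and then shrinks to [x]. *)
Definition approach (s c C rho : R) x0 x (z : nat -> 'rV[R]_n) (r : nat -> R) :=
  [/\ z 0%N = x0 /\ r 0%N = c * d x0,
      forall i, [/\ Omega (z i), 0 < r i,
        r i <= c * d (z i) & r i <= C * rho ^+ i],
      forall i, [/\ enorm (z i - z i.+1) <= r i, r i.+1 <= 2 * r i &
                    r i <= 2 * r i.+1],
      forall i, enorm (x - z i) <= C * r i `^ s &
      exists N, forall i, (N <= i)%N -> z i = x].

Lemma qh_approach (beta t eta : R) :
  0 < beta -> beta <= 1 -> qh_boundary_condition beta Omega ->
  0 < t -> t < 2 * beta / (1 + beta) -> 0 < eta ->
  exists s c C rho : R, exists x0, [/\ t < s <= 1, 0 < c <= eta, 0 < C,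
    0 < rho < 1 & Omega x0 /\ forall x, Omega x ->
      exists (z : nat -> 'rV[R]_n) (r : nat -> R), approach s c C rho x0 x z r].
Proof.
move=> beta0 beta1 qh t0 tbeta eta0.
have {}tbeta : t * (1 + beta) < 2 * beta.
  by move: tbeta; rewrite ltr_pdivlMr//; lra.
have t2 : 0 < 2 - t by nra.
(* The solution of t = 2 b0 / (1 + b0), so the bound on [t] reads b0 < beta. With b0 < b1 < b2 <
   beta, the exponent s = (b1 + b2) / (1 + b1) exceeds 2 b1 / (1 + b1) and hence [t]. *)
pose b0 := t / (2 - t).
have b0E : b0 * (2 - t) = t by rewrite divfK// gt_eqF.
have b00 : 0 < b0 by rewrite divr_gt0.
have b0b : b0 < beta by rewrite ltr_pdivrMr//; lra.
have [b1 b01 b1b] : exists2 b1, b0 < b1 & b1 < beta.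
  by exists ((b0 + beta) / 2); lra.
have [b2 b12 b2b] : exists2 b2, b1 < b2 & b2 < beta.
  by exists ((b1 + beta) / 2); lra.
have b10 : 0 < b1 by lra.
have b20 : 0 < b2 by lra.
pose s := (b1 + b2) / (1 + b1).
(* The last entry gives b2 (1 + 2 c) <= beta, hence b2 ln (1 + c) <= beta [kap]: counting steps at
   cost [kap] then yields decay at the rate b2 ln (1 + c) asked for by the chain estimates. *)
pose c := Num.min eta (Num.min 1 ((beta / b2 - 1) / 2)).
have c0 : 0 < c.
  rewrite !lt_min eta0 ltr01 /= divr_gt0// subr_gt0 ltr_pdivlMr//; lra.
have ceta : c <= eta by rewrite ge_min lexx.
have c1 : c <= 1 by rewrite !ge_min lexx orbT.
have cb : b2 * (1 + 2 * c) <= beta.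
  have : c <= (beta / b2 - 1) / 2 by rewrite !ge_min lexx !orbT.
  rewrite ler_pdivlMr// => h; rewrite mulrC -ler_pdivlMr//; lra.
pose lam := ln (1 + c).
have lam0 : 0 < lam by rewrite ln_gt0// ltrDl.
have lamc : lam <= c.
  by rewrite /lam -[leRHS]expRK ler_ln ?posrE ?addr_gt0 ?expR_gt0// expR_ge1Dx.
have [x0 Ox0 [C1 qhc]] := qh_chain Omega_domain qh c0.
pose kap := c / (1 + 2 * c).
have bk : b2 * lam <= beta * kap.
  apply: (@le_trans _ _ (b2 * c)); first by rewrite ler_pM2l.
  by rewrite /kap mulrA ler_pdivlMr; [nra|lra].
have dx0 := dist_boundary_gt0 Omega_domain Ox0.
pose A := ln (d x0) + beta * C1.
pose K := c * expR ((A - b2 * ln (d x0)) / (1 + b1)) /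
       (1 - expR (- (lam * (b2 - b1) / (1 + b1)))).
have K0 : 0 < K.
  rewrite divr_gt0// ?mulr_gt0 ?expR_gt0// subr_gt0 expR_lt1 oppr_lt0.
  by rewrite divr_gt0 ?mulr_gt0// ?subr_gt0// addr_gt0.
(* The first entry serves r_i <= C rho^i, the second |x - z_i| <= C r_i^s; c^(-s) converts d(z_i)^s
   into r_i^s. *)
pose C := Num.max (c * expR A) (K * c `^ (- s)).
have C0 : 0 < C by rewrite lt_max mulr_gt0 ?expR_gt0.
have b1p : 0 < 1 + b1 by lra.
exists s, c, C, (expR (- (b2 * lam))), x0; split => //.
- rewrite /s ltr_pdivlMr// ler_pdivrMr//; apply/andP; split; [nra|lra].
- by rewrite c0.
- by rewrite expR_gt0 expR_lt1 oppr_lt0 mulr_gt0.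
split => // x Ox; have [N [z [z0 zN zS zK]]] := qhc _ Ox.
have Oz k : (k <= N)%N -> Omega (z k).
  by case: k => [_|k kN]; [rewrite z0|have [] := zS _ kN].
have Oz0 := Oz _ (leq0n N).
have dz k : (k <= N)%N -> 0 < d (z k).
  by move=> kN; exact: dist_boundary_gt0 (Oz _ kN).
have zA i : (i <= N)%N -> ln (d (z i)) <= A - b2 * lam * i%:R.
  move=> iN; have := zK _ iN; rewrite ln_div ?posrE ?dz// -/kap => h.
  have : beta * (i%:R * kap) <= ln (d x0) - ln (d (z i)) + beta * C1.
    rewrite -(ler_pM2l beta0) in h; apply: (le_trans h).
    by rewrite mulrDr mulrA mulfV ?gt_eqF// mul1r.
  have : b2 * lam * i%:R <= beta * kap * i%:R by rewrite ler_wpM2r.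
  rewrite /A; lra.
have zE := chain_enorm_le Omega_domain b10 b12 c0 zS Oz0 zA.
(* The truncated subtraction joins two regimes: r_i = c d(z_i) along the chain, and after index [N]
   the centre stays at [x] while the radius is divided by 1 + c at each step. *)
pose r i := c * d (z (minn i N)) / (1 + c) ^+ (i - N).
have mN i : (minn i N <= N)%N by exact: geq_minr.
have cp k : 0 < (1 + c) ^+ k by rewrite exprn_gt0// addr_gt0.
have cp1 k : 1 <= (1 + c) ^+ k by rewrite exprn_ege1// lerDl ltW.
have r0 i : 0 < r i by rewrite /r divr_gt0// mulr_gt0// dz.
have rd i : r i <= c * d (z (minn i N)).
  by rewrite /r ler_pdivrMr// ler_peMr// mulr_ge0 ?ltW// dz.
exists (fun i => z (minn i N)), r; split.
- by rewrite /r min0n sub0n expr0 divr1 z0.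
- move=> i; split => //; first exact: Oz.
  apply: (@le_trans _ _ (c * expR A * expR (- (b2 * lam)) ^+ i)); last first.
    by rewrite ler_wpM2r ?exprn_ge0 ?expR_ge0// le_max lexx.
  rewrite /r -!mulrA ler_pM2l//.
  have -> : (1 + c) ^+ (i - N) = expR (lam * (i - N)%:R).
    by rewrite expRM_natr lnK// posrE addr_gt0.
  rewrite -expRN -[d _]lnK ?posrE ?dz// -expRM_natr -!expRD ler_expR.
  have := zA _ (mN i).
  have [iN|Ni] := leqP i N.
    by rewrite ?(minn_idPl iN) (eqP iN); lra.
  rewrite ?(minn_idPr (ltnW Ni)) natrB ?(ltnW Ni)// => h.
  (* Beyond [N] the ratio 1 / (1 + c) = exp(- lam) is at most rho = exp(- b2 lam), because b2 <
     1. *)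
  have : 0 <= (1 - b2) * lam * (i%:R - N%:R).
    by rewrite !mulr_ge0 ?subr_ge0 ?ler_nat ?(ltnW lam0) ?(ltnW Ni)//; lra.
  nra.
- move=> i; have [iN|Ni] := ltnP i N.
    have := zS _ iN => st.
    have h1 := chain_step_dist Omega_domain st.
    have h2 := chain_step_dist Omega_domain (chain_stepC st).
    rewrite /r ?(minn_idPl iN) ?(minn_idPl (ltnW iN)).
    have -> : (i - N = 0)%N by apply/eqP; rewrite subn_eq0 ltnW.
    have -> : (i.+1 - N = 0)%N by apply/eqP; rewrite subn_eq0.
    rewrite !expr0 !divr1; have [_ _ h _] := st.
    have di := dz _ (ltnW iN); have di1 := dz _ iN.
    by split => //; nra.
  have rS : r i.+1 * (1 + c) = r i.
    rewrite /r ?(minn_idPr Ni) ?(minn_idPr (leqW Ni)) subSn// exprS invfM.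
    by field; rewrite !gt_eqF// addr_gt0.
  rewrite ?(minn_idPr Ni) ?(minn_idPr (leqW Ni)) subrr enorm0 ltW//.
  have := r0 i.+1; have := r0 i; split => //; nra.
- move=> i; have [iN|Ni] := ltnP i N; last first.
    by rewrite ?(minn_idPr Ni) zN subrr enorm0 mulr_ge0 ?powR_ge0 ?ltW.
  rewrite /r ?(minn_idPl (ltnW iN)).
  have -> : (i - N = 0)%N by apply/eqP; rewrite subn_eq0 ltnW.
  have dzi := dz _ (ltnW iN).
  rewrite expr0 divr1 (powRM _ (ltW c0) (ltW dzi)).
  apply: (@le_trans _ _ (K * c `^ (- s) * (c `^ s * d (z i) `^ s))).
    have cs : c `^ (- s) * c `^ s = 1 by rewrite powRN mulVf// gt_eqF//
      powR_gt0.
    rewrite mulrA -(mulrA K) cs mulr1.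
    rewrite -{1}zN; apply: le_trans (zE _ (ltnW iN)) _.
    by rewrite /K z0 -/s mulrAC.
  by rewrite ler_wpM2r ?mulr_ge0 ?powR_ge0// le_max lexx orbT.
- by exists N => i Ni; rewrite ?(minn_idPr Ni).
Qed.

End approach.

(** * Chebyshev and Tonelli *)

Section chebyshev.
Context d (T : measurableType d) (R : realType).
Variable mu : {measure set T -> \bar R}.
Implicit Types (A : set T) (h : T -> \bar R).

Lemma measure_above_le A h (I m : R) : measurable A -> measurable_fun A h ->
  (forall x, A x -> 0 <= h x)%E -> (\int[mu]_(x in A) h x <= I%:E)%E ->
  0 < m -> (mu (A `&` [set x | (3 * I / m)%:E < h x]) <= (m / 3)%:E)%E.
Proof.
move=> mA mh h0 hI m0.
have mS : measurable (A `&` [set x | (3 * I / m)%:E < h x])%E.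
  exact: emeasurable_fun_o_infty.
have I0 : 0 <= I by rewrite -lee_fin (le_trans _ hI)// integral_ge0.
have hE : (\int[mu]_(x in A) `|h x| = \int[mu]_(x in A) h x)%E.
  by apply: eq_integral => x /set_mem Ax; rewrite gee0_abs// h0.
(* For I = 0 the threshold is 0 and Markov's inequality is void; instead [h] vanishes almost
   everywhere. *)
have [I00|I0'] := eqVneq I 0.
  have : (\int[mu]_(x in A) `|h x| = 0)%E.
    rewrite hE; apply/eqP; rewrite eq_le integral_ge0// andbT.
    by rewrite (le_trans hI)// I00.
  move=> /(ae_eq_integral_abs mu mA mh)[N [mN N0 subN]].
  apply: (@le_trans _ _ (mu N)); last by rewrite N0 lee_fin divr_ge0// ltW.
  apply: le_measure; rewrite ?inE// => x [Ax /=].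
  rewrite I00 mulr0 mul0r => hx; apply: subN => /= /(_ Ax) hx0.
  by rewrite hx0 ltxx in hx.
have {}I0 : 0 < I by rewrite lt_def I0'.
have a0 : 0 < 3 * I / m by rewrite !mulr_gt0// invr_gt0.
have := le_integral_abse mu mA mh a0; rewrite hE => /le_trans /(_ hI) le_I.
have : ((3 * I / m)%:E * mu (A `&` [set x | (3 * I / m)%:E < h x]) <= I%:E)%E.
  apply: le_trans le_I; rewrite lee_wpmul2l ?lee_fin ?(ltW a0)//.
  apply: le_measure; rewrite ?inE//.
    by apply: emeasurable_fun_c_infty => //; exact: measurableT_comp.
  by move=> x [Ax /= /ltW hx]; split => //=; rewrite gee0_abs// h0.
rewrite muleC -lee_pdivlMr// -EFinM => /le_trans; apply.
rewrite lee_fin le_eqVlt; apply/orP; left; apply/eqP; field.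
by rewrite !gt_eqF.
Qed.

(** Each exceptional set takes at most a third of the measure of [A], so the two together do not
    cover it; this is the origin of the factor 3. *)
Lemma exists_le_average2 A h1 h2 (I1 I2 m : R) : measurable A -> mu A = m%:E ->
  0 < m -> measurable_fun A h1 -> measurable_fun A h2 ->
  (forall x, A x -> 0 <= h1 x)%E -> (forall x, A x -> 0 <= h2 x)%E ->
  (\int[mu]_(x in A) h1 x <= I1%:E)%E -> (\int[mu]_(x in A) h2 x <= I2%:E)%E ->
  exists x, [/\ A x, (h1 x <= (3 * I1 / m)%:E)%E & (h2 x <= (3 * I2 / m)%:E)%E].
Proof.
move=> mA muA m0 mh1 mh2 h10 h20 hI1 hI2; apply/not_existsP => H.
set B1 := A `&` [set x | ((3 * I1 / m)%:E < h1 x)%E].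
set B2 := A `&` [set x | ((3 * I2 / m)%:E < h2 x)%E].
have AB : A `<=` B1 `|` B2.
  move=> x Ax; apply: contrapT => /not_orP[nB1 nB2]; apply: (H x); split => //.
    by rewrite leNgt; apply/negP => ?; exact: nB1.
  by rewrite leNgt; apply/negP => ?; exact: nB2.
have mB1 : measurable B1 by exact: emeasurable_fun_o_infty.
have mB2 : measurable B2 by exact: emeasurable_fun_o_infty.
have : (mu A <= mu B1 + mu B2)%E.
  apply: le_trans (measureU2 _ _ _) => //.
  by apply: le_measure; rewrite ?inE//; exact: measurableU.
have := measure_above_le mA mh1 h10 hI1 m0.
have := measure_above_le mA mh2 h20 hI2 m0 => hB2 hB1.
rewrite muA => /le_trans /(_ (leeD hB1 hB2)); rewrite -EFinD lee_fin; lra.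
Qed.

End chebyshev.

Section sections_tonelli.
Local Open Scope ereal_scope.
Context d1 d2 (T1 : measurableType d1) (T2 : measurableType d2) (R : realType).
Variables (m1 : {sigma_finite_measure set T1 -> \bar R})
          (m2 : {sigma_finite_measure set T2 -> \bar R}).
Variables (D : set (T1 * T2)) (f : T1 * T2 -> \bar R).
Hypotheses (mD : measurable D) (mf : measurable_fun D f)
           (f0 : forall z, D z -> 0 <= f z).

Let mfD : measurable_fun setT (f \_ D).
Proof. exact/(measurable_restrictT _ mD). Qed.

Let fD0 z : 0 <= (f \_ D) z.
Proof. by apply: erestrict_ge0. Qed.

Let sectionE1 x : \int[m2]_(y in [set y | D (x, y)]) f (x, y) =
  \int[m2]_y (f \_ D) (x, y).
Proof.
rewrite integral_mkcond; apply: eq_integral => y _; rewrite !patchE.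
by congr (if _ then _ else _); apply/idP/idP; rewrite !inE.
Qed.

Let sectionE2 y : \int[m1]_(x in [set x | D (x, y)]) f (x, y) =
  \int[m1]_x (f \_ D) (x, y).
Proof.
rewrite integral_mkcond; apply: eq_integral => x _; rewrite !patchE.
by congr (if _ then _ else _); apply/idP/idP; rewrite !inE.
Qed.

Lemma measurable_section_integral : measurable_fun setT
  (fun x => \int[m2]_(y in [set y | D (x, y)]) f (x, y)).
Proof. by under eq_fun do rewrite sectionE1;
  exact: measurable_fun_fubini_tonelli_F. Qed.

Lemma measurable_section_integral2 : measurable_fun setT
  (fun y => \int[m1]_(x in [set x | D (x, y)]) f (x, y)).
Proof. by under eq_fun do rewrite sectionE2;
  exact: measurable_fun_fubini_tonelli_G. Qed.

(** The inner domain may depend on the outer variable: [f] is extended by zero outside [D] and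
    Tonelli is applied on the full product. *)
Lemma section_tonelli :
  \int[m1]_x \int[m2]_(y in [set y | D (x, y)]) f (x, y) =
  \int[m2]_y \int[m1]_(x in [set x | D (x, y)]) f (x, y).
Proof.
transitivity (\int[m1]_x \int[m2]_y (f \_ D) (x, y)).
  by apply: eq_integral => x _; exact: sectionE1.
by rewrite fubini_tonelli//; apply: eq_integral => y _; rewrite sectionE2.
Qed.

End sections_tonelli.

(** * Integrals over cubes with a moving centre *)

Section cube_potential.
Context {R : realType} {n : nat}.
Local Notation mu := (lebesgue_rV n : {sigma_finite_measure set 'rV[R]_n ->
  \bar R}).
Variable Omega : set 'rV[R]_n.
Hypothesis mOmega : measurable Omega.
Variable G : 'rV[R]_n -> \bar R.
Hypothesis mG : measurable_fun Omega G.
Hypothesis G0 : (forall x, Omega x -> 0 <= G x)%E.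

Let D rho : set ('rV[R]_n * 'rV[R]_n) :=
  [set z | [/\ Omega z.1, Omega z.2 & cube z.1 rho z.2]].

Lemma measurable_coord_diff (i : 'I_n) :
  measurable_fun [set: 'rV[R]_n * 'rV[R]_n] (fun z => z.2 0 i - z.1 0 i).
Proof.
apply: measurable_funB.
  exact: (measurableT_comp (measurable_coord_rV i) measurable_snd).
exact: (measurableT_comp (measurable_coord_rV i) measurable_fst).
Qed.

Let mD rho : measurable (D rho).
Proof.
rewrite (_ : D rho = (Omega `*` Omega) `&` \big[setI/setT]_(i < n)
    ((fun z : 'rV[R]_n * 'rV[R]_n => `|z.2 0 i - z.1 0 i|) @^-1` `]-oo, rho[)).
  apply: measurableI; first exact: measurableX.
  apply: bigsetI_measurable => i _; rewrite -[X in measurable X]setTI.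
  have mf : measurable_fun setT (fun z : 'rV[R]_n * 'rV[R]_n =>
    `|z.2 0 i - z.1 0 i|).
    by apply: measurableT_comp => //; exact: measurable_coord_diff.
  exact: mf.
rewrite -bigcap_seq; apply/seteqP;
  split => [[x y]/= [Ox Oy xy]|[x y]/= [[Ox Oy] xy]].
  by split => // i _ /=; rewrite in_itv/=.
by split => // i; have := xy i (mem_index_enum i); rewrite /= in_itv/=.
Qed.

Let mGD rho : measurable_fun (D rho) (fun z : 'rV[R]_n * 'rV[R]_n => G z.2).
Proof.
apply: (@measurable_comp _ _ _ _ _ _ Omega) => //.
  by move=> _ [[x y] [_ Oy _] <-].
by apply: measurable_funTS; exact: measurable_snd.
Qed.

Let GD0 rho z : D rho z -> (0 <= G z.2)%E.
Proof. by case=> _ Oz _; exact: G0. Qed.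

Let sectionE rho x : Omega x -> [set y | D rho (x, y)] = Omega `&` cube x rho.
Proof. by move=> Ox; apply/seteqP; split => y /= [] //. Qed.

Lemma measurable_cube_integral rho : measurable_fun Omega
  (fun x => \int[mu]_(y in Omega `&` cube x rho) G y)%E.
Proof.
apply: (@eq_measurable_fun _ _ _ _ _ (fun x =>
  \int[mu]_(y in [set y | D rho (x, y)]) G y)%E).
  by move=> x /set_mem Ox; rewrite sectionE.
apply: measurable_funTS.
exact: (measurable_section_integral mu (mD rho) (@mGD rho) (@GD0 rho)).
Qed.

(** After the exchange, G(y) is multiplied by the measure of the x in Omega whose cube contains y.
    By symmetry this set lies in the cube of radius [rho] around y. *)
Lemma integral_cube_integral_le rho : 0 <= rho ->
  (\int[mu]_(x in Omega) \int[mu]_(y in Omega `&` cube x rho) G y <=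
   ((2 * rho) ^+ n)%:E * \int[mu]_(x in Omega) G x)%E.
Proof.
move=> rho0.
have -> : (\int[mu]_(x in Omega) \int[mu]_(y in Omega `&` cube x rho) G y =
    \int[mu]_x \int[mu]_(y in [set y | D rho (x, y)]) G y)%E.
  rewrite integral_mkcond; apply: eq_integral => x _; rewrite patchE.
  case: ifPn => [/set_mem Ox|/negP nOx]; first by rewrite sectionE.
  rewrite (_ : [set y | _] = set0) ?integral_set0//.
  by apply/seteqP; split => // y [Ox _ _]; apply: nOx; rewrite inE.
rewrite (section_tonelli mu mu (mD rho) (@mGD rho) (@GD0 rho)).
rewrite -ge0_integralZl_EFin// ?exprn_ge0 ?mulr_ge0//.
rewrite [leRHS]integral_mkcond; apply: ge0_le_integral => //.
- by move=> y _; apply: integral_ge0 => x [_ /= + _]; exact: G0.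
- exact: (measurable_section_integral2 mu (mD rho) (@mGD rho) (@GD0 rho)).
- by apply/(measurable_restrictT _ mOmega); exact: measurable_funeM.
move=> y _; rewrite patchE; case: ifPn => [/set_mem Oy|/negP nOy]; last first.
  rewrite (_ : [set x | _] = set0) ?integral_set0//.
  by apply/seteqP; split => // x [_ Oy _]; apply: nOy; rewrite inE.
rewrite (_ : [set x | _] = Omega `&` cube y rho); last first.
  by apply/seteqP; split => x /= [] // => [? ? /cubeC|? /cubeC].
rewrite /= integral_cst; last by apply: measurableI => //;
  exact: measurable_cube.
rewrite muleC lee_wpmul2r ?G0// -(lebesgue_cube y rho0).
have mC := measurable_cube y rho.
by apply: le_measure; rewrite ?inE//; exact: measurableI.
Qed.

End cube_potential.

(** * The dyadic potential *)

(** The ratio of the geometric series that bounds the integral of the dyadic potential; it is below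
    1 because b < n. *)
Lemma powR2_div_lt1 {R : realType} (b : R) n : b < n%:R -> 2 `^ b / 2 ^+ n < 1.
Proof.
move=> bn; rewrite ltr_pdivrMr ?exprn_gt0// mul1r -powR_mulrn//.
by rewrite /powR pnatr_eq0/= ltr_expR ltr_pM2r// ln_gt0// ltr1n.
Qed.

Section dyadic_potential.
Context {R : realType} {n : nat}.
Local Notation mu := (lebesgue_rV n : {sigma_finite_measure set 'rV[R]_n ->
  \bar R}).
Variable Omega : set 'rV[R]_n.
Hypothesis mOmega : measurable Omega.
Variable G : 'rV[R]_n -> \bar R.
Hypothesis mG : measurable_fun Omega G.
Hypothesis G0 : (forall x, Omega x -> 0 <= G x)%E.
Variables b rad : R.
Hypothesis rad0 : 0 < rad.

(* Comparable to [\int_Omega |x - y|^(-b) G y dy], up to a constant. *)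
Definition dyadic_potential x : \bar R :=
  (\sum_(k <oo) ((2 `^ b) ^+ k)%:E *
    \int[mu]_(y in Omega `&` cube x (rad / 2 ^+ k)) G y)%E.

Let term_ge0 x k : (0 <= ((2 `^ b) ^+ k)%:E *
    \int[mu]_(y in Omega `&` cube x (rad / 2 ^+ k)) G y)%E.
Proof.
rewrite mule_ge0 ?lee_fin ?exprn_ge0 ?powR_ge0//.
by apply: integral_ge0 => y [+ _]; exact: G0.
Qed.

Lemma dyadic_potential_ge0 x : (0 <= dyadic_potential x)%E.
Proof. by apply: nneseries_ge0 => k _ _; exact: term_ge0. Qed.

Lemma measurable_dyadic_potential : measurable_fun Omega dyadic_potential.
Proof.
apply: ge0_emeasurable_sum => // k _.
by apply: measurable_funeM; exact: measurable_cube_integral.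
Qed.

Lemma geometric_nneseries_le (a q : R) : 0 <= a -> 0 < q -> q < 1 ->
  (\sum_(k <oo) (a * q ^+ k)%:E <= (a / (1 - q))%:E)%E.
Proof.
move=> a0 q0 q1; apply: lime_le.
  by apply: is_cvg_nneseries => k _ _;
    rewrite lee_fin mulr_ge0 ?exprn_ge0// ltW.
apply: nearW => m; rewrite sumEFin lee_fin.
have q1' : `|q| < 1 by rewrite ger0_norm ?ltW.
exact: (geometric_le_lim m a0 q0 q1').
Qed.

(** The term of index k integrates to at most 2^(b k) (2 rad / 2^k)^n J, a geometric sequence of
    ratio 2^b / 2^n. *)
Lemma integral_dyadic_potential_le (J : R) : b < n%:R ->
  (\int[mu]_(x in Omega) G x <= J%:E)%E ->
  (\int[mu]_(x in Omega) dyadic_potential x <=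
    ((2 * rad) ^+ n / (1 - 2 `^ b / 2 ^+ n) * J)%:E)%E.
Proof.
move=> bn GJ.
have J0 : 0 <= J by rewrite -lee_fin (le_trans _ GJ)// integral_ge0.
rewrite integral_nneseries//; last first.
  by move=> k; apply: measurable_funeM; exact: measurable_cube_integral.
have q0 : 0 < 2 `^ b / 2 ^+ n :> R by rewrite divr_gt0 ?powR_gt0 ?exprn_gt0.
have q1 : 2 `^ b / 2 ^+ n < 1 :> R.
  exact: powR2_div_lt1.
rewrite mulrAC; apply: le_trans (geometric_nneseries_le _ q0 q1); last first.
  by rewrite mulr_ge0// exprn_ge0// mulr_ge0// ltW.
apply: lee_nneseries => [k _ _|k _].
  by apply: integral_ge0 => x _; exact: term_ge0.
rewrite ge0_integralZl_EFin ?exprn_ge0 ?powR_ge0//; last 2 first.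
- by move=> x _; apply: integral_ge0 => y [+ _]; exact: G0.
- exact: measurable_cube_integral.
have rk0 : 0 <= rad / 2 ^+ k by rewrite divr_ge0 ?exprn_ge0// ltW.
have h := integral_cube_integral_le mOmega mG G0 rk0.
have c0 : (0 <= ((2 * (rad / 2 ^+ k)) ^+ n)%:E)%E.
  by rewrite lee_fin exprn_ge0// mulr_ge0.
have {}h := le_trans h (lee_wpmul2l c0 GJ).
apply: le_trans (lee_wpmul2l _ h) _;
  first by rewrite lee_fin exprn_ge0 ?powR_ge0.
rewrite -!EFinM lee_fin le_eqVlt; apply/orP; left; apply/eqP.
rewrite !exprMn !exprVn -!exprM (mulnC n k); field.
by rewrite !expf_neq0// pnatr_eq0.
Qed.

(** A single term suffices: for the largest k with v <= rad / 2^k the cube of that level still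
    contains [S], while 2^k > rad / (2 v). *)
Lemma dyadic_potential_ge (S : set 'rV[R]_n) x (v : R) : 0 <= b -> measurable
  S ->
  0 < v -> v <= rad -> S `<=` Omega `&` cube x v ->
  (((rad / (2 * v)) `^ b)%:E * \int[mu]_(y in S) G y <= dyadic_potential x)%E.
Proof.
move=> b0 mS v0 vr SO.
have exk : exists k, rad < v * 2 ^+ k.+1.
  exists (Num.truncn (rad / v)); rewrite mulrC -ltr_pdivrMr//.
  apply: lt_le_trans (truncnS_gt _) _; rewrite -natrX ler_nat.
  exact: ltnW (ltn_expl _ _).
case: (ex_minnP exk) => k kr mink.
have vk : v <= rad / 2 ^+ k.
  rewrite ler_pdivlMr ?exprn_gt0//.
  case: k mink {kr} => [|k] mink; first by rewrite expr0 mulr1.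
  by rewrite leNgt; apply/negP => /mink; rewrite ltnn.
rewrite /dyadic_potential (@nneseriesD1 _ _ k)//.
apply: (@le_trans _ _ (((2 `^ b) ^+ k)%:E *
    \int[mu]_(y in Omega `&` cube x (rad / 2 ^+ k)) G y)%E); last first.
  by rewrite leeDl// nneseries_ge0// => j _ _; exact: term_ge0.
have subk : S `<=` Omega `&` cube x (rad / 2 ^+ k).
  by move=> y /SO[Oy xy]; split => // i; exact: lt_le_trans vk.
have mk : measurable (Omega `&` cube x (rad / 2 ^+ k)).
  by apply: measurableI => //; exact: measurable_cube.
apply: lee_pmul.
- by rewrite lee_fin powR_ge0.
- by apply: integral_ge0 => y /SO[+ _]; exact: G0.
- rewrite lee_fin -powR_mulrn ?powR_ge0// powRAC powR_mulrn//.
  apply: ge0_ler_powR; rewrite ?nnegrE ?exprn_ge0 ?divr_ge0 ?mulr_ge0 ?(ltW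
    v0) ?(ltW rad0)//.
  by rewrite ler_pdivrMr ?mulr_gt0//; move: kr; rewrite exprS; lra.
- apply: ge0_subset_integral => //;
  first by apply: measurable_funS mG => // y [].
  by move=> y [+ _]; exact: G0.
Qed.

End dyadic_potential.

(** * The pointwise estimate *)

Section fractional_density.
Context {R : realType} {n : nat}.
Local Notation mu := (lebesgue_rV n : {sigma_finite_measure set 'rV[R]_n ->
  \bar R}).
Variable Omega : set 'rV[R]_n.
Hypothesis Omega_domain : proper_domain Omega.
Variables (delta tau p : R) (u : 'rV[R]_n -> R).
Hypothesis p_gt0 : 0 < p.
Hypothesis delta_gt0 : 0 < delta.
Hypothesis uc : {within Omega, continuous u}.
Implicit Types x y : 'rV[R]_n.

Local Notation d := (dist_boundary Omega).

Definition frac_quotient x y : R :=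
  `|u x - u y| `^ p / enorm (x - y) `^ (n%:R + p * delta).

Definition frac_density x : \bar R :=
  (\int[mu]_(y in Omega `&` eball x (tau * d x)) (frac_quotient x y)%:E)%E.

Let Omega_open : open Omega.
Proof. by case: Omega_domain => -[]. Qed.

Let mOmega : measurable Omega.
Proof. exact: open_measurable_rV. Qed.

Let mu_u : measurable_fun Omega u.
Proof. exact: within_continuous_measurable_rV. Qed.

Lemma frac_quotient_ge0 x y : 0 <= frac_quotient x y.
Proof. by rewrite divr_ge0 ?powR_ge0. Qed.

Lemma frac_density_ge0 x : (0 <= frac_density x)%E.
Proof. by apply: integral_ge0 => y _; rewrite lee_fin frac_quotient_ge0. Qed.

Lemma measurable_diff_powR (a e : R) :
  measurable_fun Omega (fun y => `|a - u y| `^ e).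
Proof.
apply: (measurableT_comp (measurable_powR e)).
apply: (measurableT_comp (@normr_measurable R setT)).
exact: measurable_funB.
Qed.

Let m_enorm x : measurable_fun [set: 'rV[R]_n] (fun y => enorm (y - x)).
Proof.
have md : measurable_fun [set: 'rV[R]_n] (fun y => y - x).
  apply: measurable_fun_rV => i; under eq_fun do rewrite !mxE.
  by apply: measurable_funB => //; exact: measurable_coord_rV.
exact: (measurableT_comp (continuous_measurable_rV (@enorm_continuous R n)) md).
Qed.

Lemma measurable_eball x r : measurable (eball x r).
Proof.
rewrite -[X in measurable X]setTI.
exact: (measurable_fun_ltr (m_enorm x) (@measurable_cst _ _ _ _ _ r)).
Qed.

Lemma measurable_frac_quotient x :
  measurable_fun Omega (fun y => (frac_quotient x y)%:E).
Proof.
apply/measurable_EFinP; rewrite /frac_quotient.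
under eq_fun do rewrite enormB -powRN.
apply: measurable_funM; first exact: measurable_diff_powR.
apply: (measurableT_comp (measurable_powR _)).
exact: measurable_funTS (m_enorm x).
Qed.

Let D : set ('rV[R]_n * 'rV[R]_n) :=
  [set z | [/\ Omega z.1, Omega z.2 & enorm (z.2 - z.1) < tau * d z.1]].

Let m_enorm_diff : measurable_fun [set: 'rV[R]_n * 'rV[R]_n]
  (fun z => enorm (z.2 - z.1)).
Proof.
have md : measurable_fun [set: 'rV[R]_n * 'rV[R]_n] (fun z => z.2 - z.1).
  apply: measurable_fun_rV => i; under eq_fun do rewrite !mxE.
  exact: measurable_coord_diff.
exact: (measurableT_comp (continuous_measurable_rV (@enorm_continuous R n)) md).
Qed.

Let mD : measurable D.
Proof.
have mt : measurable_fun [set: 'rV[R]_n * 'rV[R]_n] (fun z => tau * d z.1).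
  apply: measurable_funM => //.
  exact: (measurableT_comp (measurable_dist_boundary Omega_domain)
    measurable_fst).
rewrite (_ : D = (Omega `*` Omega) `&`
    (setT `&` [set z | enorm (z.2 - z.1) < tau * d z.1])).
  by apply: measurableI; [exact: measurableX|exact: measurable_fun_ltr].
by rewrite setTI; apply/seteqP; split => [[x y] []|[x y] [[]]].
Qed.

Let m_quotient : measurable_fun D (fun z => (frac_quotient z.1 z.2)%:E).
Proof.
have mu1 : measurable_fun D (fun z => u z.1).
  apply: (@measurable_comp _ _ _ _ _ _ Omega) => //.
    by move=> _ [[x y] [Ox _ _] <-].
  by apply: measurable_funTS; exact: measurable_fst.
have mu2 : measurable_fun D (fun z => u z.2).
  apply: (@measurable_comp _ _ _ _ _ _ Omega) => //.
    by move=> _ [[x y] [_ Oy _] <-].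
  by apply: measurable_funTS; exact: measurable_snd.
apply/measurable_EFinP; rewrite /frac_quotient.
under eq_fun do rewrite enormB -powRN.
apply: measurable_funM.
  apply: (measurableT_comp (measurable_powR p)).
  apply: (measurableT_comp (@normr_measurable R setT)).
  exact: measurable_funB.
apply: (measurableT_comp (measurable_powR _)).
exact: measurable_funTS m_enorm_diff.
Qed.

Lemma measurable_frac_density : measurable_fun Omega frac_density.
Proof.
apply: (@eq_measurable_fun _ _ _ _ _
    (fun x => \int[mu]_(y in [set y | D (x, y)]) (frac_quotient x y)%:E)%E).
  move=> x /set_mem Ox; rewrite /frac_density; congr (integral _ _ _).
  by apply/seteqP; split => y /= [].
apply: measurable_funTS.
apply: (measurable_section_integral mu mD m_quotient).
by move=> z _; rewrite lee_fin frac_quotient_ge0.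
Qed.

Variable c : R.
Hypotheses (c_gt0 : 0 < c) (c_small : c * (4 * n%:R) <= 1)
  (c_tau : c * (16 * n%:R) <= tau) (n_gt0 : (0 < n)%N).

(** As c <= 1 / (4 n), the cube lies in the Euclidean ball of radius d(z) / 4 around z. *)
Lemma cube_subset_domain z r y : Omega z -> 0 < r -> r <= c * d z ->
  cube z r y -> Omega y /\ d z <= 2 * d y.
Proof.
move=> Oz r0 rc zy; have := cube_enorm_le (ltW r0) zy.
have dz := dist_boundary_gt0 Omega_domain Oz.
have nr : n%:R * r <= n%:R * (c * d z) by rewrite ler_wpM2l.
have cd : c * (4 * n%:R) * d z <= 1 * d z by rewrite ler_wpM2r// ltW.
move=> h; split; first by apply: (dist_boundary_in Omega_domain Oz); lra.
have := dist_boundary_lip Omega_domain z y; rewrite enormB; lra.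
Qed.

(** Points of consecutive cubes are at distance at most n r + r + n r' <= 4 n r, as r' <= 2 r and n
    >= 1. *)
Let K0 : R := 4 * n%:R.

Lemma cubes_enorm_le z z' r r' y y' : enorm (z - z') <= r -> r' <= 2 * r ->
  0 < r -> 0 < r' -> cube z r y -> cube z' r' y' -> enorm (y' - y) <= K0 * r.
Proof.
move=> zz' r'r r0 r'0 zy zy'.
have h1 := cube_enorm_le (ltW r0) zy; have h2 := cube_enorm_le (ltW r'0) zy'.
have := enorm_triangle z y' y; have := enorm_triangle z' y' z.
rewrite (enormB z' z) (enormB z y) => h3 h4.
have n1 : 1 * r <= n%:R * r by rewrite ler_wpM2r ?(ltW r0)// ler1n.
have : n%:R * r' <= n%:R * (2 * r) by rewrite ler_wpM2l.
rewrite /K0; lra.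
Qed.

(** Chebyshev's inequality is applied on the next cube to two functions at once: to the density, so
    that the construction can continue, and to |u y - u|^p. The integral of the latter is controlled
    by the density at [y], since the next cube lies in the ball over which that density is taken. *)
Lemma exists_next_point z z' r r' y (I I' : R) : Omega z -> Omega z' ->
  0 < r -> 0 < r' -> r <= c * d z -> r' <= c * d z' ->
  enorm (z - z') <= r -> r' <= 2 * r -> r <= 2 * r' -> cube z r y ->
  (frac_density y <= (3 * I / (2 * r) ^+ n)%:E)%E ->
  (\int[mu]_(x in cube z' r') frac_density x <= I'%:E)%E ->
  exists y', [/\ cube z' r' y', (frac_density y' <= (3 * I' / (2 * r') ^+
    n)%:E)%E &
    `|u y - u y'| `^ p <=
      9 * K0 `^ (n%:R + p * delta) * r `^ (p * delta - n%:R) * I].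
Proof.
move=> Oz Oz' r0 r'0 rc r'c zz' r'r rr' zy Gy GI'.
have [Oy dzy] := cube_subset_domain Oz r0 rc zy.
(* The factor 16 n in the bound on [c]: K0 r = 4 n r <= 8 n c d(y) < 16 n c d(y) <= tau d(y). *)
have sub : cube z' r' `<=` Omega `&` eball y (tau * d y).
  move=> y' zy'; split; first exact: (cube_subset_domain Oz' r'0 r'c zy').1.
  rewrite /eball/=; apply: le_lt_trans (cubes_enorm_le zz' r'r r0 r'0 zy zy') _.
  have dy := dist_boundary_gt0 Omega_domain Oy.
  have cn0 : 0 < c * n%:R by rewrite mulr_gt0// ltr0n.
  have : c * (16 * n%:R) * d y <= tau * d y by rewrite ler_wpM2r// ltW.
  have : n%:R * r <= n%:R * (c * (2 * d y)).
    by rewrite ler_wpM2l// (le_trans rc)// ler_pM2l.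
  have : 0 < c * n%:R * d y by rewrite mulr_gt0.
  rewrite /K0; lra.
have subO : cube z' r' `<=` Omega by move=> y' /sub[].
set a := n%:R + p * delta.
have a0 : 0 < a by rewrite addr_gt0 ?mulr_gt0// ltr0n.
have K0r0 : 0 < K0 * r by rewrite !mulr_gt0// ltr0n.
have mC := measurable_cube z' r'.
have mdiff : measurable_fun (cube z' r') (fun y' => `|u y - u y'| `^ p).
  exact: measurable_funS (measurable_diff_powR (u y) p).
have mB : measurable (Omega `&` eball y (tau * d y)).
  by apply: measurableI => //; exact: measurable_eball.
have mq : measurable_fun (Omega `&` eball y (tau * d y))
    (fun y' => (frac_quotient y y')%:E).
  by apply: measurable_funS (measurable_frac_quotient y) => // y' [].
have hI2 : (\int[mu]_(y' in cube z' r') (`|u y - u y'| `^ p)%:E <=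
    ((K0 * r) `^ a * (3 * I / (2 * r) ^+ n))%:E)%E.
  apply: (@le_trans _ _ (\int[mu]_(y' in cube z' r')
      (((K0 * r) `^ a)%:E * (frac_quotient y y')%:E))%E).
    apply: ge0_le_integral => //.
    - exact/measurable_EFinP.
    - by apply: measurable_funeM; exact: measurable_funS mq.
    move=> y' zy'; rewrite -EFinM lee_fin /frac_quotient -/a.
    (* On the diagonal both sides vanish, because 0 to the power p is 0 for p > 0. *)
    have [yy|yy] := eqVneq y y'.
      by rewrite yy subrr normr0 powR0 ?gt_eqF// mul0r mulr0.
    have e0 : 0 < enorm (y - y').
      by rewrite (lt_le_trans _ (mx_norm_le_enorm _))// normr_gt0 subr_eq0.
    rewrite mulrCA ler_peMr ?powR_ge0// ler_pdivlMr ?powR_gt0// mul1r.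
    apply: ge0_ler_powR; rewrite ?nnegrE ?(ltW a0) ?(ltW e0) ?(ltW K0r0)//.
    by rewrite enormB; exact: cubes_enorm_le zy zy'.
  rewrite ge0_integralZl_EFin ?powR_ge0//; last 2 first.
  - by move=> y' _; rewrite lee_fin frac_quotient_ge0.
  - exact: measurable_funS mq.
  rewrite EFinM lee_wpmul2l ?lee_fin ?powR_ge0//; apply: le_trans Gy.
  apply: ge0_subset_integral => // y' _.
  by rewrite lee_fin frac_quotient_ge0.
have m0 : 0 < (2 * r') ^+ n by rewrite exprn_gt0// mulr_gt0.
have [y' [zy' Gy' uy']] := exists_le_average2 mC (lebesgue_cube z' (ltW r'0)) m0
  (measurable_funS mOmega subO measurable_frac_density)
  ((measurable_EFinP _ _).2 mdiff) (fun x _ => frac_density_ge0 x)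
  (fun x _ => powR_ge0 _ _) GI' hI2.
exists y'; split => //; move: uy'; rewrite lee_fin => /le_trans; apply.
have I0 : 0 <= I.
  have := le_trans (frac_density_ge0 y) Gy; rewrite lee_fin.
  by rewrite pmulr_lge0 ?invr_gt0 ?exprn_gt0 ?mulr_gt0// pmulr_rge0.
rewrite powRM ?(ltW r0)//; last by rewrite /K0 mulr_ge0.
(* The exponent collects n + p delta from the kernel and -n from each of the two means, over the
   cubes of radii r and r'; the constant 9 is the product of their factors 3. *)
have -> : r `^ (p * delta - n%:R) = r `^ a / (r ^+ n * r ^+ n).
  rewrite -!powR_mulrn ?ltW// -powRD ?(gt_eqF r0) ?implybT// -powRB ?(gt_eqF
    r0) ?implybT//.
  by congr (_ `^ _); rewrite /a; lra.
have h1 : r ^+ n <= (2 * r) ^+ n by apply: lerXn2r; rewrite ?nnegrE; lra.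
have h2 : r ^+ n <= (2 * r') ^+ n by apply: lerXn2r; rewrite ?nnegrE; lra.
have rn : 0 < r ^+ n by rewrite exprn_gt0.
have -> : 3 * (K0 `^ a * r `^ a * (3 * I / (2 * r) ^+ n)) / (2 * r') ^+ n =
   9 * K0 `^ a * r `^ a * I * ((2 * r) ^+ n * (2 * r') ^+ n)^-1.
  by rewrite invfM; ring.
have -> : 9 * K0 `^ a * (r `^ a / (r ^+ n * r ^+ n)) * I =
   9 * K0 `^ a * r `^ a * I * (r ^+ n * r ^+ n)^-1 by ring.
rewrite ler_wpM2l ?mulr_ge0 ?powR_ge0// lef_pV2 ?posrE ?mulr_gt0 ?exprn_gt0
  ?mulr_gt0//.
by apply: ler_pM => //; exact: ltW.
Qed.

End fractional_density.

Lemma powR_le_inj {R : realType} (p a b : R) : 0 < p -> 0 <= a -> 0 <= b ->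
  a `^ p <= b `^ p -> a <= b.
Proof.
move=> p0 a0 b0; apply: contraTT; rewrite -!ltNge => ba.
by apply: gt0_ltr_powR; rewrite ?nnegrE.
Qed.

Lemma powR_lt1 {R : realType} (a e : R) : 0 < a < 1 -> 0 < e -> a `^ e < 1.
Proof.
move=> /andP[a0 a1] e0; have -> : 1 = 1 `^ e :> R by rewrite powR1.
by apply: gt0_ltr_powR; rewrite ?nnegrE ?(ltW a0).
Qed.

Section pointwise_bound.
Context {R : realType} {n : nat}.
Local Notation mu := (lebesgue_rV n : {sigma_finite_measure set 'rV[R]_n ->
  \bar R}).
Variable Omega : set 'rV[R]_n.
Hypothesis Omega_domain : proper_domain Omega.
Variables (delta tau p : R) (u : 'rV[R]_n -> R).
Hypothesis p_gt0 : 0 < p.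
Hypothesis delta_gt0 : 0 < delta.
Hypothesis uc : {within Omega, continuous u}.
Variable c : R.
Hypotheses (c_gt0 : 0 < c) (c_small : c * (4 * n%:R) <= 1)
  (c_tau : c * (16 * n%:R) <= tau) (n_gt0 : (0 < n)%N).

Local Notation d := (dist_boundary Omega).
Local Notation G := (frac_density Omega delta tau p u).

Let Omega_open : open Omega.
Proof. by case: Omega_domain => -[]. Qed.

Let mOmega : measurable Omega.
Proof. exact: open_measurable_rV. Qed.

Let mG : measurable_fun Omega G.
Proof. exact: measurable_frac_density. Qed.

(** Provides y_0. The zero function fills the second slot of [exists_le_average2], as there is no
    earlier point to compare with. *)
Lemma exists_first_point z r (I : R) : Omega z -> 0 < r -> r <= c * d z ->
  (\int[mu]_(x in cube z r) G x <= I%:E)%E ->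
  exists y, cube z r y /\ (G y <= (3 * I / (2 * r) ^+ n)%:E)%E.
Proof.
move=> Oz r0 rc GI.
have sub : cube z r `<=` Omega.
  by move=> y zy; have [] := cube_subset_domain Omega_domain c_small Oz r0 rc
    zy.
have m0 : 0 < (2 * r) ^+ n by rewrite exprn_gt0// mulr_gt0.
have i0 : (\int[mu]_(x in cube z r) cst 0 x <= 0%:E)%E by rewrite integral0.
have [y [zy Gy _]] := exists_le_average2 (measurable_cube z r)
  (lebesgue_cube z (ltW r0)) m0 (measurable_funS mOmega sub mG)
  (measurable_cst _) (fun x _ => frac_density_ge0 _ _ _ _ _ x)
  (fun x _ => lexx _) GI i0.
by exists y.
Qed.

Definition step_constant : R := 9 * (4 * n%:R) `^ (n%:R + p * delta).

(** The weight [w] will be a power of the potential at [x]; the factor r_i^eps <= C^eps rho^(eps i)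
    makes the increments between the chosen points summable, and continuity carries the bound to
    [x]. *)
Lemma approach_telescope (s C rho eps w : R) x0 x y0 (z : nat -> 'rV[R]_n)
    (r I : nat -> R) :
  0 < C -> 0 < rho < 1 -> 0 < eps -> 0 <= w -> Omega x ->
  approach Omega s c C rho x0 x z r ->
  (forall i, (\int[mu]_(x in cube (z i) (r i)) G x <= (I i)%:E)%E) ->
  cube (z 0%N) (r 0%N) y0 -> (G y0 <= (3 * I 0%N / (2 * r 0%N) ^+ n)%:E)%E ->
  (forall i, step_constant * r i `^ (p * delta - n%:R) * I i <=
             (w * r i `^ eps) `^ p) ->
  `|u x - u y0| <= w * C `^ eps / (1 - rho `^ eps).
Proof.
move=> C0 rho01 eps0 w0 Ox [_ zr zs _ [N zN]] GI zy0 Gy0 hw.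
case/andP: (rho01) => rho0 rho1.
pose P i y := cube (z i) (r i) y /\ (G y <= (3 * I i / (2 * r i) ^+ n)%:E)%E.
(* The invariant [P] is a premise inside the existential, so that [choice] gives a total function
   which can be iterated from [y0]. *)
have next (a : nat * 'rV[R]_n) : exists y', P a.1 a.2 -> P a.1.+1 y' /\
    `|u a.2 - u y'| `^ p <= step_constant * r a.1 `^ (p * delta - n%:R) * I a.1.
  case: a => i y; have [[zy Gy]|nP] := pselect (P i y); last by exists y => /nP.
  have [Oz r0 rc _] := zr i; have [Oz' r'0 r'c _] := zr i.+1.
  have [zz' r'r rr'] := zs i.
  have [y' [zy' Gy' uy']] := exists_next_point Omega_domain p_gt0 delta_gt0 uc
    c_gt0 c_small c_tau n_gt0 Oz Oz' r0 r'0 rc r'c zz' r'r rr' zy Gy (GI i.+1).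
  by exists y' => _; split.
have [f fP] := choice next.
pose y := fix y i := if i is i'.+1 then f (i', y i') else y0.
have yP i : P i (y i).
  by elim: i => [|i ih]; [split|exact: (fP (i, y i) ih).1].
have ystep i : `|u (y i) - u (y i.+1)| <= w * C `^ eps * (rho `^ eps) ^+ i.
  have [_ r0 _ rC] := zr i.
  apply: (@le_trans _ _ (w * r i `^ eps)).
    apply: (powR_le_inj p_gt0) => //; first by rewrite mulr_ge0// powR_ge0.
    by apply: le_trans (hw i); exact: (fP (i, y i) (yP i)).2.
  rewrite -mulrA ler_wpM2l// -powR_mulrn ?powR_ge0// powRAC powR_mulrn ?(ltW
    rho0)//.
  rewrite -powRM ?(ltW C0) ?exprn_ge0 ?(ltW rho0)//.
  apply: ge0_ler_powR; rewrite ?nnegrE ?(ltW eps0) ?(ltW r0)//.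
  by rewrite mulr_ge0 ?exprn_ge0 ?(ltW C0) ?(ltW rho0).
have rhoe1 := powR_lt1 rho01 eps0.
have ybound m : `|u (y m) - u y0| <= w * C `^ eps / (1 - rho `^ eps).
  apply: (@geometric_step_le _ (fun k => `|u (y k) - u y0|)).
  - by rewrite mulr_ge0 ?powR_ge0.
  - exact: powR_ge0.
  - exact: rhoe1.
  - by rewrite subrr normr0.
  move=> k _; apply: le_trans (ler_distD (u (y k)) _ _) _.
  by rewrite addrC lerD2l distrC ystep.
apply/ler_addgt0Pr => e e0.
have ux : {for x, continuous u}.
  by move: uc; rewrite continuous_open_subspace//; apply; rewrite inE.
have /nbhs_cube[l l0 lu] : nbhs x (u @^-1` ball (u x) e).
  by apply: ux; exact: nbhsx_ballx.
(* From [N] on the cubes are centred at [x] and their radii tend to 0, so some chosen point lies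
   where u is within [e] of u(x). *)
have [m [Nm rm]] : exists m, (N <= m)%N /\ r m < l.
  have rho1' : `|rho| < 1 by rewrite gtr0_norm.
  have /cvgrPdist_lt/(_ l l0)[M _ hM] := cvg_geometric C rho1'.
  exists (maxn N M); split; first exact: leq_maxl.
  have [_ _ _ rC] := zr (maxn N M); apply: le_lt_trans rC _.
  have /= := hM (maxn N M) (leq_maxr _ _).
  by rewrite sub0r normrN ger0_norm// mulr_ge0 ?exprn_ge0 ?(ltW C0) ?(ltW rho0).
have [zy _] := yP m.
have : ball (u x) e (u (y m)).
  by apply: lu => j; rewrite -(zN m Nm); exact: lt_trans (zy j) rm.
rewrite /ball/= => h; have := ybound m.
have := ler_distD (u (y m)) (u x) (u y0); lra.
Qed.

End pointwise_bound.

(** * Pointwise bound by the dyadic potential *)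

Section pointwise_potential.
Context {R : realType} {n : nat}.
Local Notation mu := (lebesgue_rV n : {sigma_finite_measure set 'rV[R]_n ->
  \bar R}).
Variable Omega : set 'rV[R]_n.
Hypothesis Omega_domain : proper_domain Omega.
Variables (delta tau p q : R) (u : 'rV[R]_n -> R).
Hypothesis p_gt0 : 0 < p.
Hypothesis p_le_q : p <= q.
Hypothesis delta_gt0 : 0 < delta.
Hypothesis uc : {within Omega, continuous u}.
Variables (c s C rho eps b : R) (x0 : 'rV[R]_n).
Hypotheses (c_gt0 : 0 < c) (c_small : c * (4 * n%:R) <= 1)
  (c_tau : c * (16 * n%:R) <= tau) (n_gt0 : (0 < n)%N).
Hypotheses (s_gt0 : 0 < s) (s_le1 : s <= 1) (C_gt0 : 0 < C)
  (rho_in : 0 < rho < 1) (eps_gt0 : 0 < eps) (b_ge0 : 0 <= b)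
  (sbE : s * b = q * (n%:R / p - delta + eps)).

Local Notation d := (dist_boundary Omega).
Local Notation G := (frac_density Omega delta tau p u).

Local Notation sc := (step_constant (n := n) delta p).

(** The value at r = C of (C + C^(1-s)) r^s, which dominates r + C r^s for all r <= C, as r =
    r^(1-s) r^s. *)
Definition potential_radius : R := (C + C `^ (1 - s)) * C `^ s.

Local Notation W := (dyadic_potential Omega G b potential_radius).

(** The factors come, in order, from one step of the chain, from the lower bound of the potential on
    one cube, and from the geometric sum. *)
Definition pointwise_constant : R :=
  sc `^ (q / p) * (2 / C `^ s) `^ b *
  (C `^ eps / (1 - rho `^ eps)) `^ q.

Variable J : R.
Hypothesis GJ : (\int[mu]_(x in Omega) G x = J%:E)%E.

Let Omega_open : open Omega.
Proof. by case: Omega_domain => -[]. Qed.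

Let mOmega : measurable Omega.
Proof. exact: open_measurable_rV. Qed.

Let mG : measurable_fun Omega G.
Proof. exact: measurable_frac_density. Qed.

Let G0 x : Omega x -> (0 <= G x)%E.
Proof. by move=> _; exact: frac_density_ge0. Qed.

Let J_ge0 : 0 <= J.
Proof. by rewrite -lee_fin -GJ; apply: integral_ge0. Qed.

Let q_gt0 : 0 < q. Proof. exact: lt_le_trans p_le_q. Qed.

Let mass (S : set 'rV[R]_n) : R := fine (\int[mu]_(x in S) G x)%E.

Let massE (S : set 'rV[R]_n) : measurable S -> S `<=` Omega ->
  [/\ (\int[mu]_(x in S) G x = (mass S)%:E)%E, 0 <= mass S & mass S <= J].
Proof.
move=> mS SO.
have S0 : (0 <= \int[mu]_(x in S) G x)%E by apply: integral_ge0 => x /SO /G0.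
have SJ : (\int[mu]_(x in S) G x <= J%:E)%E.
  by rewrite -GJ; apply: ge0_subset_integral.
have SE : (\int[mu]_(x in S) G x = (mass S)%:E)%E.
  by rewrite fineK// ge0_fin_numE// (le_lt_trans SJ)// ltry.
by split => //; rewrite -lee_fin -SE.
Qed.

Lemma step_constant_gt0 : 0 < sc.
Proof. by rewrite /step_constant mulr_gt0// powR_gt0// mulr_gt0// ltr0n. Qed.

Let rhoe : rho `^ eps < 1. Proof. exact: powR_lt1. Qed.

Lemma pointwise_constant_gt0 : 0 < pointwise_constant.
Proof.
rewrite /pointwise_constant !mulr_gt0// ?powR_gt0 ?step_constant_gt0//.
  by rewrite divr_gt0 ?powR_gt0.
by rewrite divr_gt0 ?powR_gt0// subr_gt0.
Qed.

Lemma potential_radius_gt0 : 0 < potential_radius.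
Proof. by rewrite mulr_gt0 ?addr_gt0 ?powR_gt0. Qed.

(** Since |x - z| <= C r^s, the cube lies in one around [x] of radius comparable to r^s, where the
    potential has weight comparable to r^(- s b). *)
Lemma cube_le_potential (x z : 'rV[R]_n) (r : R) : 0 < r -> r <= C ->
  enorm (x - z) <= C * r `^ s -> cube z r `<=` Omega ->
  (((C `^ s / 2) `^ b * r `^ (- (s * b)) * mass (cube z r))%:E <= W x)%E.
Proof.
move=> r0 rC xz zO.
have [mE _ _] := massE (measurable_cube z r) zO.
pose v := (C + C `^ (1 - s)) * r `^ s.
have CC0 : 0 < C + C `^ (1 - s) by rewrite addr_gt0 ?powR_gt0.
have rs0 : 0 < r `^ s by rewrite powR_gt0.
have v0 : 0 < v by rewrite mulr_gt0.
have rsC : r `^ s <= C `^ s.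
  by apply: ge0_ler_powR; rewrite ?nnegrE ?(ltW s_gt0) ?(ltW r0) ?(ltW C_gt0).
have vrad : v <= potential_radius by rewrite /v /potential_radius ler_pM2l.
have rv : r + C * r `^ s <= v.
  rewrite /v mulrDl addrC lerD2l.
  have {1}-> : r = r `^ (1 - s) * r `^ s.
    by rewrite -powRD ?(gt_eqF r0) ?implybT// subrK powRr1// ltW.
  rewrite ler_pM2r//; apply: ge0_ler_powR;
    rewrite ?nnegrE ?subr_ge0 ?(ltW r0) ?(ltW C_gt0)//.
have sub : cube z r `<=` Omega `&` cube x v.
  move=> y zy; split; first exact: zO.
  move=> i; apply: lt_le_trans rv.
  have := le_trans (coord_le_enorm (x - z) i) xz; rewrite !mxE distrC => h.
  by have := zy i; have := ler_distD (z 0 i) (y 0 i) (x 0 i); lra.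
have := dyadic_potential_ge mOmega mG G0 potential_radius_gt0 b_ge0
  (measurable_cube z r) v0 vrad sub.
rewrite mE -EFinM; apply: le_trans; rewrite lee_fin le_eqVlt; apply/orP; left.
apply/eqP; congr (_ * _).
have -> : potential_radius / (2 * v) = C `^ s / 2 * (r `^ s)^-1.
  rewrite /potential_radius /v; field.
  by rewrite (gt_eqF rs0) (gt_eqF CC0).
by rewrite [RHS]powRM ?invr_ge0 ?divr_ge0 ?powR_ge0// -[in RHS]powRN -[in
  RHS]powRrM mulNr.
Qed.

Lemma approach_pointwise x (z : nat -> 'rV[R]_n) (r : nat -> R) y0 :
  Omega x -> approach Omega s c C rho x0 x z r ->
  cube x0 (c * d x0) y0 ->
  (G y0 <= (3 * mass (cube x0 (c * d x0)) / (2 * (c * d x0)) ^+ n)%:E)%E ->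
  ((`|u x - u y0| `^ q)%:E <= (pointwise_constant * J `^ (q / p - 1))%:E * W
    x)%E.
Proof.
move=> Ox ap cy0 Gy0; have [[z0 r0] zr zs xz _] := ap.
have qp1 : 1 <= q / p by rewrite ler_pdivlMr// mul1r.
have subO i : cube (z i) (r i) `<=` Omega.
  have [Oz ri0 rc _] := zr i.
  by move=> y zy; have [] := cube_subset_domain Omega_domain c_small Oz ri0 rc
    zy.
have W0 : (0 <= W x)%E by apply: dyadic_potential_ge0.
(* If the potential is infinite, so is the right-hand side as soon as J > 0; and J = 0 would make
   every term of the potential vanish. *)
case WE : (W x) W0 => [w| |]// w0; last first.
  rewrite muleC gt0_mulye ?leey// lte_fin mulr_gt0 ?pointwise_constant_gt0//.
  rewrite powR_gt0// lt_def J_ge0 andbT; apply/eqP => J0.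
  move: WE; rewrite /dyadic_potential eseries0// => k _ _.
  have [-> m0 mJ] := massE (measurableI _ _ mOmega
    (measurable_cube x (potential_radius / 2 ^+ k))) (@subIsetl _ _ _).
  by rewrite (_ : mass _ = 0) ?mule0//; apply/eqP;
    rewrite eq_le m0 andbT -[leRHS]J0.
rewrite lee_fin in w0.
pose K2 := sc `^ (q / p) * (2 / C `^ s) `^ b.
(* Chosen so that the step hypothesis [hw], raised to the power q / p, becomes linear in the mass of
   the cube and in the potential. *)
pose om := (K2 * J `^ (q / p - 1) * w) `^ q^-1.
have K20 : 0 <= K2 by rewrite mulr_ge0 ?powR_ge0.
have om0 : 0 <= om by exact: powR_ge0.
have omq : om `^ q = K2 * J `^ (q / p - 1) * w.
  rewrite /om -powRrM mulVf ?gt_eqF// powRr1//.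
  by rewrite !mulr_ge0 ?powR_ge0.
pose I i := mass (cube (z i) (r i)).
have GI i : (\int[mu]_(x in cube (z i) (r i)) G x <= (I i)%:E)%E.
  by have [-> _ _] := massE (measurable_cube (z i) (r i)) (subO i).
have hw i : sc * r i `^ (p * delta - n%:R) * I i <=
    (om * r i `^ eps) `^ p.
  have [Oz ri0 rc rC] := zr i.
  have rC' : r i <= C.
    case/andP: rho_in => rho0 rho1; apply: le_trans rC _.
    by rewrite ler_piMr ?(ltW C_gt0)// exprn_ile1// ltW.
  have [_ I0 IJ] := massE (measurable_cube (z i) (r i)) (subO i).
  have := cube_le_potential ri0 rC' (xz i) (subO i).
  rewrite WE lee_fin -/(I i) => hI.
  have Iqp : I i `^ (q / p) <= J `^ (q / p - 1) * I i.
    have [->|In0] := eqVneq (I i) 0.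
      by rewrite mulr0 powR0// gt_eqF// (lt_le_trans _ qp1).
    rewrite -{1}(subrK 1 (q / p)) powRD ?In0 ?implybT// powRr1// ler_wpM2r//.
    by apply: ge0_ler_powR; rewrite ?nnegrE ?subr_ge0.
  apply: (@powR_le_inj _ (q / p)).
  - by rewrite divr_gt0.
  - by rewrite !mulr_ge0 ?powR_ge0// ltW// step_constant_gt0.
  - exact: powR_ge0.
  rewrite -powRrM mulrCA mulfV ?gt_eqF// mulr1 [leRHS]powRM ?powR_ge0// omq.
  rewrite powRM ?mulr_ge0 ?powR_ge0 ?(ltW step_constant_gt0)//.
  rewrite powRM ?powR_ge0 ?(ltW step_constant_gt0)// -!powRrM.
  apply: (@le_trans _ _ (sc `^ (q / p) *
     r i `^ ((p * delta - n%:R) * (q / p)) * (J `^ (q / p - 1) * I i))).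
    by rewrite ler_wpM2l// mulr_ge0 ?powR_ge0.
  have Cb0 : 0 < (C `^ s / 2) `^ b by rewrite powR_gt0// divr_gt0 ?powR_gt0.
  have rsb0 : 0 < r i `^ (s * b) by rewrite powR_gt0.
  have hI' : I i <= (2 / C `^ s) `^ b * r i `^ (s * b) * w.
    have E : (2 / C `^ s) `^ b = ((C `^ s / 2) `^ b)^-1.
      apply: (mulIf (lt0r_neq0 Cb0)); rewrite mulVf ?gt_eqF//.
      rewrite -powRM ?divr_ge0 ?powR_ge0// -[X in X `^ b](mulrA 2) mulKf.
        by rewrite divff// powR1.
      by rewrite gt_eqF// powR_gt0.
    rewrite E; move: hI Cb0 rsb0; rewrite powRN.
    set A := (_ / 2) `^ b; set B := r i `^ _ => hI A0 B0.
    rewrite {1}(_ : I i = A^-1 * B * (A * B^-1 * I i)); last first.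
      by field; rewrite !gt_eqF.
    by rewrite ler_wpM2l// mulr_ge0 ?invr_ge0 ?(ltW A0) ?(ltW B0).
  apply: (@le_trans _ _ (sc `^ (q / p) * r i `^ ((p * delta - n%:R) * (q / p)) *
     (J `^ (q / p - 1) * ((2 / C `^ s) `^ b * r i `^ (s * b) * w)))).
    by rewrite ler_wpM2l ?mulr_ge0 ?powR_ge0// ler_wpM2l ?powR_ge0.
  (* The relation [sbE] balances the powers of r_i: the scaling of one step and the potential weight
     leave exactly r_i^(eps q). *)
  have -> : r i `^ (eps * q) =
      r i `^ ((p * delta - n%:R) * (q / p)) * r i `^ (s * b).
    rewrite -powRD ?(gt_eqF ri0) ?implybT// sbE; congr (_ `^ _).
    by field; rewrite gt_eqF.
  by rewrite /K2 le_eqVlt; apply/orP; left; apply/eqP; ring.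
have Cy0 : cube (z 0%N) (r 0%N) y0 by rewrite z0 r0.
have Gy0' : (G y0 <= (3 * I 0%N / (2 * r 0%N) ^+ n)%:E)%E by rewrite /I z0 r0.
have := approach_telescope Omega_domain p_gt0 delta_gt0 uc c_gt0 c_small c_tau
  n_gt0 C_gt0 rho_in eps_gt0 om0 Ox ap GI Cy0 Gy0' hw.
rewrite -mulrA => h.
rewrite -EFinM lee_fin.
have -> : pointwise_constant * J `^ (q / p - 1) * w =
  (om * (C `^ eps / (1 - rho `^ eps))) `^ q.
  rewrite powRM ?omq ?divr_ge0 ?powR_ge0 ?subr_ge0 ?(ltW rhoe)//.
  by rewrite /pointwise_constant -/K2; ring.
apply: ge0_ler_powR; rewrite ?nnegrE ?(ltW q_gt0)//.
by rewrite mulr_ge0 ?divr_ge0 ?powR_ge0 ?subr_ge0 ?(ltW rhoe).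
Qed.

End pointwise_potential.

(** * The inequality *)

Lemma powRD_le {R : realType} (q a b : R) : 0 <= q -> 0 <= a -> 0 <= b ->
  (a + b) `^ q <= 2 `^ q * (a `^ q + b `^ q).
Proof.
move=> q0; wlog ab : a b / a <= b => [hw a0 b0|a0 b0].
  have [ab|/ltW ba] := leP a b; first exact: hw.
  by rewrite addrC (addrC (a `^ q)); exact: hw.
apply: (@le_trans _ _ ((2 * b) `^ q)).
  by apply: ge0_ler_powR; rewrite ?nnegrE ?addr_ge0 ?mulr_ge0//; lra.
by rewrite powRM// ler_wpM2l ?powR_ge0// lerDr powR_ge0.
Qed.

(** * From an arbitrary constant to the average *)

Section average_change.
Context d (T : measurableType d) (R : realType).
Variable mu : {measure set T -> \bar R}.
Variables (A : set T) (m q a U : R) (u : T -> R).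
Hypotheses (mA : measurable A) (muA : mu A = m%:E) (m_gt0 : 0 < m).
Hypotheses (q_ge1 : 1 <= q) (mu_u : measurable_fun A u).
Hypothesis uU : (\int[mu]_(x in A) (`|u x - a| `^ q)%:E <= U%:E)%E.

Let q_gt0 : 0 < q. Proof. exact: lt_le_trans q_ge1. Qed.

Let mua : measurable_fun A (fun x => u x - a).
Proof. exact: measurable_funB. Qed.

Let mnua : measurable_fun A (fun x => `|u x - a|).
Proof. by apply: measurableT_comp. Qed.

Let mpow : measurable_fun A (fun x => `|u x - a| `^ q).
Proof. exact: (measurableT_comp (measurable_powR q)). Qed.

Let U_ge0 : 0 <= U.
Proof.
by rewrite -lee_fin (le_trans _ uU)// integral_ge0// => x _;
  rewrite lee_fin powR_ge0.
Qed.

(** Stands in for Hölder's inequality: for t >= lam one has t / lam <= (t / lam)^q, and integrating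
    with lam^q >= U bounds the L^1 norm by lam (m + 1). *)
Let norm_le (lam t : R) : 0 < lam -> 0 <= t ->
  t <= lam + lam / lam `^ q * t `^ q.
Proof.
move=> l0 t0; have lq0 : 0 < lam `^ q by rewrite powR_gt0.
have [tl|/ltW lt] := leP t lam.
  by rewrite (le_trans tl)// lerDl mulr_ge0 ?powR_ge0// divr_ge0 ?powR_ge0
    ?(ltW l0).
rewrite -[leLHS]add0r lerD ?(ltW l0)//.
have h : 1 <= t / lam by rewrite ler_pdivlMr// mul1r.
have := ler_powR h q_ge1; rewrite powRr1 ?divr_ge0 ?(ltW l0)//.
rewrite ler_pdivrMr// => /le_trans; apply.
rewrite powRM ?invr_ge0 ?(ltW l0)// -powR_inv1 ?(ltW l0)// -powRrM mulN1r powRN.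
by rewrite le_eqVlt; apply/orP; left; apply/eqP; field; rewrite gt_eqF.
Qed.

Let L1_le (lam : R) : 0 < lam -> U <= lam `^ q ->
  (\int[mu]_(x in A) (`|u x - a|)%:E <= (lam * (m + 1))%:E)%E.
Proof.
move=> l0 Ul; have lq0 : 0 < lam `^ q by rewrite powR_gt0.
apply: (@le_trans _ _ (\int[mu]_(x in A)
    (lam%:E + (lam / lam `^ q)%:E * (`|u x - a| `^ q)%:E))%E).
  apply: ge0_le_integral => //.
  - exact/measurable_EFinP.
  - by apply: emeasurable_funD => //; apply: measurable_funeM;
    exact/measurable_EFinP.
  - by move=> x _; rewrite -EFinM -EFinD lee_fin norm_le.
have c0 : 0 <= lam / lam `^ q by rewrite divr_ge0// ltW.
rewrite ge0_integralD//; last 3 first.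
- by move=> x _; rewrite lee_fin (ltW l0).
- by move=> x _; rewrite -EFinM lee_fin mulr_ge0 ?powR_ge0.
- by apply: measurable_funeM; exact/measurable_EFinP.
rewrite integral_cst// muA ge0_integralZl_EFin//; last exact/measurable_EFinP.
rewrite mulrDr EFinD -EFinM; apply: leeD => //.
have c0E : (0 <= (lam / lam `^ q)%:E)%E by rewrite lee_fin.
apply: le_trans (lee_wpmul2l c0E uU) _; rewrite -EFinM lee_fin mulr1.
by rewrite mulrAC -mulrA ler_piMr ?(ltW l0)// ler_pdivrMr// mul1r.
Qed.

(** Without integrability the real-valued integral would be a default value; here it becomes
    additive, so subtracting [a] commutes with averaging. *)
Let integrable_ua : mu.-integrable A (EFin \o (fun x => u x - a)).
Proof.
apply/integrableP; split; first exact/measurable_EFinP.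
have l0 : 0 < (U + 1) `^ q^-1 by rewrite powR_gt0// ltr_wpDl.
apply: le_lt_trans (L1_le l0 _) _; last exact: ltry.
by rewrite -powRrM mulVf ?gt_eqF// powRr1 ?addr_ge0// lerDl.
Qed.

Let avg := m^-1 * \int[mu]_(x in A) u x.

Let avgE : avg - a = m^-1 * \int[mu]_(x in A) (u x - a).
Proof.
have integrable_a : mu.-integrable A (EFin \o (fun=> a)).
  apply/integrableP; split; first exact/measurable_EFinP.
  by rewrite /= integral_cst// muA -EFinM ltry.
rewrite /avg; have -> : \int[mu]_(x in A) u x = \int[mu]_(x in A) ((u x - a) +
  a).
  by apply: eq_Rintegral => x _; rewrite subrK.
rewrite RintegralD// Rintegral_cst// muA /= mulrDr mulrCA mulVf ?gt_eqF// mulr1.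
by rewrite addrK.
Qed.

Let avg_le : `|avg - a| `^ q <= ((m + 1) / m) `^ q * U.
Proof.
have h lam : 0 < lam -> U <= lam `^ q -> `|avg - a| <= lam * ((m + 1) / m).
  move=> l0 Ul; rewrite avgE normrM gtr0_norm ?invr_gt0// mulrA.
  rewrite ler_pdivlMr// mulrAC mulVf ?gt_eqF// mul1r.
  rewrite -lee_fin EFin_normr_Rintegral//.
  have mE : measurable_fun A (fun x => (u x - a)%:E) by exact/measurable_EFinP.
  exact: le_trans (le_abse_integral mu mA mE) (L1_le l0 Ul).
have mm0 : 0 < (m + 1) / m by rewrite divr_gt0// addr_gt0.
(* The choice lam = U^(1/q) is not positive when U = 0; then every lam > 0 is admissible and the
   difference is 0. *)
have [U0|U0] := eqVneq U 0.
  suff -> : `|avg - a| = 0 by rewrite powR0 ?gt_eqF// U0 mulr0.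
  apply/eqP; rewrite eq_le normr_ge0 andbT; apply/ler_addgt0Pr => e e0.
  have e1 : 0 < e / ((m + 1) / m) by rewrite divr_gt0.
  by rewrite add0r; have := h _ e1; rewrite U0 divfK ?gt_eqF//; apply;
    exact: powR_ge0.
have Up : 0 < U by rewrite lt_def U0.
have l0 : 0 < U `^ q^-1 by rewrite powR_gt0.
have UE : U = (U `^ q^-1) `^ q by rewrite -powRrM mulVf ?gt_eqF// powRr1.
rewrite [X in _ * X]UE -powRM ?(ltW mm0) ?(ltW l0)//.
have hl : `|avg - a| <= (m + 1) / m * U `^ q^-1 by rewrite mulrC h// -UE.
apply: ge0_ler_powR => //; rewrite ?nnegrE ?(ltW q_gt0)//.
by rewrite mulr_ge0 ?(ltW mm0) ?(ltW l0).
Qed.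

Lemma average_change : (\int[mu]_(x in A) (`|u x - avg| `^ q)%:E <=
  (2 `^ q * (1 + m * ((m + 1) / m) `^ q) * U)%:E)%E.
Proof.
pose B := ((m + 1) / m) `^ q * U.
have B0 : 0 <= B by rewrite mulr_ge0 ?powR_ge0.
apply: (@le_trans _ _ (\int[mu]_(x in A)
    ((2 `^ q)%:E * ((`|u x - a| `^ q)%:E + B%:E)))%E).
  apply: ge0_le_integral => //.
  - apply/measurable_EFinP; apply: (measurableT_comp (measurable_powR q)).
    by apply: measurableT_comp => //; exact: measurable_funB.
  - by apply: measurable_funeM; apply: emeasurable_funD => //;
    exact/measurable_EFinP.
  move=> x _; rewrite -EFinD -EFinM lee_fin.
  apply: (@le_trans _ _ ((`|u x - a| + `|avg - a|) `^ q)).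
    apply: ge0_ler_powR; rewrite ?nnegrE ?addr_ge0 ?(ltW q_gt0)//.
    by rewrite (distrC avg); exact: ler_distD.
  apply: le_trans (powRD_le (ltW q_gt0) _ _) _ => //.
  by rewrite ler_wpM2l ?powR_ge0// lerD2l.
rewrite ge0_integralZl_EFin ?powR_ge0//; last 2 first.
- by move=> x _; rewrite -EFinD lee_fin addr_ge0 ?powR_ge0.
- by apply: emeasurable_funD => //; exact/measurable_EFinP.
rewrite ge0_integralD//; last exact/measurable_EFinP.
rewrite integral_cst// muA -EFinM.
rewrite [leRHS](_ : _ = (2 `^ q)%:E * (U + B * m)%:E)%E; last first.
  by rewrite -EFinM; congr EFin; rewrite /B; ring.
by rewrite lee_wpmul2l ?lee_fin ?powR_ge0// EFinD; exact: leeD.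
Qed.

End average_change.

Lemma lebesgue_bounded_domain {R : realType} n (Omega : set 'rV[R]_n) x0 (r :
  R) :
  open Omega -> Omega x0 -> 0 <= r -> (forall x,
    Omega x -> enorm (x - x0) < r) ->
  exists2 m : R, lebesgue_rV n Omega = m%:E & 0 < m.
Proof.
move=> oO Ox0 r0 Or; have mO := open_measurable_rV oO.
have sub : Omega `<=` cube x0 r by move=> x /Or /enorm_lt_cube.
have le_r : (lebesgue_rV n Omega <= ((2 * r) ^+ n)%:E)%E.
  rewrite -(lebesgue_cube x0 r0); apply: le_measure; rewrite ?inE//.
  exact: measurable_cube.
have OE : lebesgue_rV n Omega = (fine (lebesgue_rV n Omega))%:E.
  by rewrite fineK// ge0_fin_numE// (le_lt_trans le_r)// ltry.
exists (fine (lebesgue_rV n Omega)) => //.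
have [l l0 lO] := nbhs_cube (open_nbhs_nbhs (conj oO Ox0)).
rewrite -lte_fin -OE; apply: (@lt_le_trans _ _ (lebesgue_rV n (cube x0 l))).
  by rewrite lebesgue_cube ?(ltW l0)// lte_fin exprn_gt0// mulr_gt0.
by apply: le_measure; rewrite ?inE//; exact: measurable_cube.
Qed.

Theorem theorem0p4 (R : realType) (n : nat) (delta tau beta p q : R)
    (Omega : set 'rV[R]_n)
    (n_ge2 : (2 <= n)%N)
    (delta_in : delta \in `]0, 1[)
    (tau_gt0 : 0 < tau)
    (beta_in : beta \in `]0, 1])
    (Omega_domain : proper_domain Omega)
    (Omega_qh : qh_boundary_condition beta Omega)
    (p_ge1 : 1 <= p)
    (p_in : p \in `]1 / delta * (n%:R - n%:R * (2 * beta / (1 + beta))), n%:R[)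
    (q_in : q \in `[p, 2 * beta / (1 + beta) * (n%:R * p / (n%:R - p * delta))[) :
  fractional_sobolev_poincare delta tau q p Omega.
Proof.
have n0 : (0 < n)%N by exact: ltn_trans n_ge2.
have nR0 : 0 < n%:R :> R by rewrite ltr0n.
move: delta_in beta_in p_in q_in; rewrite !in_itv/=.
move=> /andP[delta0 delta1] /andP[beta0 beta1] /andP[_ pn] /andP[pq qs].
have p0 : 0 < p by lra.
have q0 : 0 < q by lra.
have npd0 : 0 < n%:R - p * delta by nra.
(* Solves n t = q (n / p - delta), the exponent of r_i needed before the loss eps; the upper bound
   on q becomes t < 2 beta / (1 + beta). *)
pose t := q * (n%:R - p * delta) / (n%:R * p).
have np0 : 0 < n%:R * p by rewrite mulr_gt0.
have t0 : 0 < t by rewrite divr_gt0// mulr_gt0.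
have ts0 : t < 2 * beta / (1 + beta).
  by rewrite /t ltr_pdivrMr// -ltr_pdivlMr// -mulrA.
(* The first entry keeps the cubes well inside Omega, the second keeps the next cube within the ball
   of radius tau d(y). *)
pose eta := Num.min (1 / (4 * n%:R)) (tau / (16 * n%:R)).
have eta0 : 0 < eta by rewrite lt_min !divr_gt0 ?mulr_gt0.
have [s [c [C [rho [x0 [/andP[ts s1] /andP[c0 ceta] C0 rho01 [Ox0 appr]]]]]]] :=
  qh_approach Omega_domain beta0 beta1 Omega_qh t0 ts0 eta0.
have c_small : c * (4 * n%:R) <= 1.
  by rewrite -ler_pdivlMr ?mulr_gt0// (le_trans ceta)// ge_min lexx.
have c_tau : c * (16 * n%:R) <= tau.
  by rewrite -ler_pdivlMr ?mulr_gt0// (le_trans ceta)// ge_min lexx orbT.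
have s0 : 0 < s by exact: lt_trans ts.
(* Half of the gap is spent here: s b = n t + n (s - t) / 2 stays below n s, so b < n. *)
pose eps := n%:R * (s - t) / (2 * q).
have eps0 : 0 < eps by rewrite divr_gt0 ?mulr_gt0// subr_gt0.
pose b := q * (n%:R / p - delta + eps) / s.
have sbE : s * b = q * (n%:R / p - delta + eps) by rewrite /b mulrC divfK//
  gt_eqF.
have qE : q * (n%:R / p - delta + eps) = n%:R * t + n%:R * (s - t) / 2.
  by rewrite /eps /t; field; rewrite !gt_eqF.
have b0 : 0 <= b.
  have h1 : 0 <= n%:R * t by rewrite mulr_ge0 ?(ltW t0).
  have h2 : 0 <= n%:R * (s - t) by rewrite mulr_ge0// subr_ge0 ltW.
  by rewrite /b qE divr_ge0 ?(ltW s0)//; lra.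
have bn : b < n%:R.
  by rewrite /b qE ltr_pdivrMr//; nra.
have oO : open Omega by case: Omega_domain => -[].
have mO := open_measurable_rV oO.
have dx0 := dist_boundary_gt0 Omega_domain Ox0.
(* The approach estimate at index 0 bounds |x - x0| uniformly, so Omega is bounded; the added 1
   makes the inequality strict. *)
have [m mE m0] : exists2 m : R, lebesgue_rV n Omega = m%:E & 0 < m.
  apply: (@lebesgue_bounded_domain _ _ _ x0
    (C * (c * dist_boundary Omega x0) `^ s + 1)) => //.
    by rewrite addr_ge0// mulr_ge0 ?powR_ge0// ltW.
  move=> x Ox; have [z [r [[z0 r0] _ _ xz _]]] := appr x Ox.
  by have := xz 0%N; rewrite z0 r0; lra.
pose rad := potential_radius s C.
have rad0 : 0 < rad by exact: potential_radius_gt0.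
pose Kpot := (2 * rad) ^+ n / (1 - 2 `^ b / 2 ^+ n).
pose Kpw := pointwise_constant (n := n) delta p q s C rho eps b.
have Kpw0 : 0 < Kpw by exact: pointwise_constant_gt0.
pose Kavg := 2 `^ q * (1 + m * ((m + 1) / m) `^ q).
have Kavg0 : 0 < Kavg.
  by rewrite mulr_gt0 ?powR_gt0// ltr_pwDl// mulr_ge0 ?powR_ge0 ?(ltW m0).
have Kpot0 : 0 < Kpot.
  apply: divr_gt0; first by rewrite exprn_gt0// mulr_gt0.
  by rewrite subr_gt0 powR2_div_lt1.
exists (Kavg * (Kpw * Kpot)) => u uc.
have muu := within_continuous_measurable_rV oO uc.
set G := frac_density Omega delta tau p u.
have mG : measurable_fun Omega G by exact: measurable_frac_density.
have G0 x : Omega x -> (0 <= G x)%E by move=> _; exact: frac_density_ge0.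
rewrite [X in (_ <= _ * X `^ _)%E](_ : _ = \int[lebesgue_rV n]_(x in Omega) G
  x)%E//.
have qp0 : q / p != 0 by rewrite gt_eqF// divr_gt0.
have : (0 <= \int[lebesgue_rV n]_(x in Omega) G x)%E by exact: integral_ge0.
(* For infinite energy the right-hand side is infinite, as q / p is nonzero and the constant
   positive. *)
case GJ : (\int[lebesgue_rV n]_(x in Omega) G x)%E => [J| |]// J0; last first.
  have K0 : 0 < Kavg * (Kpw * Kpot) by rewrite mulr_gt0// mulr_gt0.
  by rewrite poweRyr// gt0_muley ?leey// lte_fin.
rewrite lee_fin in J0.
pose I0 := fine (\int[lebesgue_rV n]_(x in cube x0 (c * dist_boundary Omega
  x0)) G x).
have r00 : 0 < c * dist_boundary Omega x0 by rewrite mulr_gt0.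
have GI0 : (\int[lebesgue_rV n]_(x in cube x0 (c * dist_boundary Omega x0)) G
  x <=
    I0%:E)%E.
  rewrite /I0 fineK// ge0_fin_numE; last first.
    by apply: integral_ge0 => x _; exact: frac_density_ge0.
  apply: le_lt_trans (ltry J); rewrite -GJ; apply: ge0_subset_integral => //.
    exact: measurable_cube.
  by move=> y zy; have [] := cube_subset_domain Omega_domain c_small Ox0 r00
    (lexx _) zy.
have [y0 [cy0 Gy0]] := exists_first_point Omega_domain uc c_small Ox0 r00
  (lexx _) GI0.
have main : (\int[lebesgue_rV n]_(x in Omega) (`|u x - u y0| `^ q)%:E <=
    (Kpw * Kpot * J `^ (q / p))%:E)%E.
  apply: (@le_trans _ _ (\int[lebesgue_rV n]_(x in Omega)
     ((Kpw * J `^ (q / p - 1))%:E * dyadic_potential Omega G b rad x))%E).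
    apply: ge0_le_integral => //.
    - by apply/measurable_EFinP; apply: (measurableT_comp (measurable_powR q));
        apply: measurableT_comp => //; exact: measurable_funB.
    - by apply: measurable_funeM; exact: measurable_dyadic_potential.
    move=> x Ox; have [z [r ap]] := appr x Ox.
    exact: (approach_pointwise Omega_domain p0 pq delta0 uc c0 c_small c_tau
      n0 s0 s1
      C0 rho01 eps0 b0 sbE GJ Ox ap cy0 Gy0).
  rewrite ge0_integralZl_EFin//; last 3 first.
  - by move=> x _; exact: dyadic_potential_ge0.
  - exact: measurable_dyadic_potential.
  - by rewrite mulr_ge0 ?powR_ge0 ?(ltW Kpw0).
  have k0 : (0 <= (Kpw * J `^ (q / p - 1))%:E)%E.
    by rewrite lee_fin mulr_ge0 ?powR_ge0 ?(ltW Kpw0).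
  have GJ' : (\int[lebesgue_rV n]_(x in Omega) G x <= J%:E)%E by rewrite GJ.
  apply: le_trans (lee_wpmul2l k0 (integral_dyadic_potential_le mO mG G0 rad0
    bn GJ')) _.
  rewrite -EFinM lee_fin -/Kpot.
  have -> : J `^ (q / p) = J `^ (q / p - 1) * J.
    have [->|Jn0] := eqVneq J 0; first by rewrite mulr0 powR0.
    by rewrite -{1}(subrK 1 (q / p)) powRD ?Jn0 ?implybT// powRr1.
  by rewrite le_eqVlt; apply/orP; left; apply/eqP; ring.
have q1 : 1 <= q by lra.
have := average_change mO mE m0 q1 muu main.
rewrite /average mE poweR_EFin -EFinM -/Kavg; congr (_ <= _)%E.
by congr EFin; ring.
Qed.
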